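(* Let $X$ be an infinite-dimensional complex Banach space, let $T$ be a bounded linear operator on $X$, and let $\varepsilon>0$. Then there exists a bounded linear operator $F$ on $X$ of rank at most one with $\|F\|<\varepsilon$ such that $T-F$ has an invariant half-space, i.e. there is a closed subspace $L\subset X$ of infinite dimension and infinite codimension with $(T-F)L\subset L$.
   Context: A half-space of a Banach space $X$ is a closed subspace of $X$ that has infinite dimension and infinite codimension. *)

(* Defs.v *)
From HB Require Import structures.
From mathcomp Require Import all_boot all_order all_algebra.
From mathcomp Require Import all_classical all_reals all_analysis.
From mathcomp Require Import complex.
Import Order.TTheory GRing.Theory Num.Theory.
Local Open Scope ring_scope.
Local Open Scope complex_scope.
Local Open Scope classical_set_scope.

Set Implicit Arguments.
Unset Strict Implicit.
Unset Printing Implicit Defensive.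

Section Defs.
Variables (R : realType) (V : normedModType R[i]).

Definition bounded_operator (T : {linear V -> V}) : Prop := continuous T.

Definition lin_indep (n : nat) (v : 'I_n -> V) : Prop :=
  forall a : 'I_n -> R[i], \sum_(i < n) a i *: v i = 0 -> forall i, a i = 0.

(* the family v is linearly independent modulo the subspace L, i.e. its
   image in the quotient V/L is linearly independent *)
Definition lin_indep_mod (L : set V) (n : nat) (v : 'I_n -> V) : Prop :=
  forall a : 'I_n -> R[i], L (\sum_(i < n) a i *: v i) -> forall i, a i = 0.

Definition infinite_dimensional_space : Prop :=
  forall n : nat, exists v : 'I_n -> V, lin_indep v.

Definition linear_subspace (L : set V) : Prop :=
  L 0 /\ (forall x y, L x -> L y -> L (x + y)) /\
  (forall (a : R[i]) x, L x -> L (a *: x)).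

Definition infinite_dimensional (L : set V) : Prop :=
  forall n : nat, exists v : 'I_n -> V, (forall i, L (v i)) /\ lin_indep v.

Definition infinite_codimensional (L : set V) : Prop :=
  forall n : nat, exists v : 'I_n -> V, lin_indep_mod L v.

Definition half_space (L : set V) : Prop :=
  linear_subspace L /\ closed L /\ infinite_dimensional L /\
  infinite_codimensional L.

Definition op_invariant (T : V -> V) (L : set V) : Prop :=
  forall x, L x -> L (T x).

Definition rank_le1 (F : V -> V) : Prop :=
  exists y : V, forall x, exists a : R[i], F x = a *: y.

(* ||F|| < e, where ||F|| = inf { c | forall x, |F x| <= c |x| } (the
   infimum is attained, so this is equivalent to the operator norm being < e) *)
Definition opnorm_lt (F : V -> V) (e : R) : Prop :=
  exists2 c : R, c < e & forall x, `|F x| <= c%:C * `|x|.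

End Defs.

(* Main.v *)
Require Import Defs.
From HB Require Import structures.
From mathcomp Require Import all_boot all_order all_algebra.
From mathcomp Require Import all_classical all_reals all_analysis.
From mathcomp Require Import complex.
From mathcomp Require Import ring lra.
Import Order.TTheory GRing.Theory Num.Theory.
Local Open Scope ring_scope.
Local Open Scope complex_scope.
Local Open Scope classical_set_scope.

Set Implicit Arguments.
Unset Strict Implicit.
Unset Printing Implicit Defensive.

(** Write S = T - lam and R_z = (T - z)^-1.  Suppose that (v_i) is a bounded
    family of vectors, not relatively compact, with (T - z_i) v_i = c_i e and
    c_i -> 0.  A gliding construction extracts a sequence v_k and functionals
    f_k that are biorthogonal up to fast decaying errors, so that some small
    functional f satisfies f (v_k) = c_k for every even k.  The v_k with k even
    are then eigenvectors of T - f (x) e and span a half-space, the v_k with k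
    odd witnessing the infinite codimension.  The same works with an invariant
    subspace M divided out, and with functionals g_i such that
    g_i o (T - z_i) = c_i f in place of the vectors v_i, the half-space being
    the common kernel of the extracted functionals.

    Families of this kind come from the resolvent.  Either T is algebraic, and
    then some T - a has an infinite dimensional kernel, or by Liouville's
    theorem there is lam such that no R_z S^k stays bounded as z -> lam.  If
    ker S^k = ker S^(k+1), take v_z = R_z e modulo ker S^k.  If ker S is finite
    dimensional and the kernels keep growing, there is an infinite Jordan chain
    x_0 = S x_1, x_1 = S x_2, ..., and one takes g_z = f o R_z on its closed
    span, where f (x_0) = 1.  Rescaled to norm one, neither family is
    relatively compact, because a limit would be annihilated by S. *)

(** * Norms and limits *)

(** The obstacle is exactness: one small rank one operator must match infinitely many values [c_k]
    at once, while the norms of the dual vectors grow without control. So each tolerance is fixed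
    before the next index is known, and the index is then taken far enough along an ultrafilter.
    Ultrafilter limits stand in for weak-star compactness, and distances to a subspace stand in for
    quotient norms. Boundedness of [R_z S^k] near [lam] says that [lam] is at worst a pole. If this
    holds at every point (with some polynomial in [T] in place of [S^k]), compactness yields one
    polynomial [p] with all [R_z p(T)] uniformly bounded; then [R_z p(T)^3 x] satisfies a second
    order estimate off finitely many points and vanishes at infinity, so [p(T)^3 = 0]. Stability of
    [ker S^k] is what turns a limit killed by [S] modulo [ker S^k] into 0 modulo [ker S^k]. With
    growing kernels this inference fails, hence the passage to functionals: there the blow-up is
    automatic, as [R_z x_0 = -x_0 / (z - lam)], and a limit killed by [S] vanishes on the chain
    because every [x_n] is in the range of [S]. *)

Definition nm (R : realType) (V : normedZmodType R[i]) (x : V) : R := complex.Re `|x|.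

Section Norm.
Variables (R : realType) (V : normedZmodType R[i]).
Implicit Types x y : V.

Lemma nmE x : `|x| = (nm x)%:C.
Proof. by rewrite /nm RRe_real ?normr_real. Qed.

Lemma nm_ge0 x : 0 <= nm x.
Proof. by have := normr_ge0 x; rewrite nmE ler0c. Qed.

Lemma nm0 : nm (0 : V) = 0.
Proof. by rewrite /nm normr0. Qed.

Lemma nm_eq0 x : (nm x == 0) = (x == 0).
Proof. by rewrite -[RHS]normr_eq0 nmE -(inj_eq (@complexI R)). Qed.

Lemma nm_gt0 x : (0 < nm x) = (x != 0).
Proof. by rewrite lt_neqAle nm_ge0 andbT eq_sym nm_eq0. Qed.

Lemma nmD x y : nm (x + y) <= nm x + nm y.
Proof. by rewrite -lecR rmorphD /= -!nmE ler_normD. Qed.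

Lemma nmN x : nm (- x) = nm x.
Proof. by rewrite /nm normrN. Qed.

Lemma nmBC x y : nm (x - y) = nm (y - x).
Proof. by rewrite /nm distrC. Qed.

Lemma nmB x y : nm (x - y) <= nm x + nm y.
Proof. by rewrite -(nmN y); exact: nmD. Qed.

Lemma nm_tri y x z : nm (x - z) <= nm (x - y) + nm (y - z).
Proof. by rewrite -{1}(subrK y x) -addrA; exact: nmD. Qed.

Lemma nm_sub x y : nm x - nm y <= nm (x - y).
Proof. by have := nmD (x - y) y; rewrite subrK; lra. Qed.

Lemma nm_sum n (f : 'I_n -> V) : nm (\sum_i f i) <= \sum_i nm (f i).
Proof.
elim/big_ind2: _ => //; first by rewrite nm0.
by move=> a b c d ab cd; apply: le_trans (nmD _ _) _; lra.
Qed.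

Lemma nm_eps0 x : (forall e, 0 < e -> nm x <= e) -> x = 0.
Proof.
move=> h; apply/eqP; rewrite -nm_eq0 eq_le nm_ge0 andbT.
by apply/ler_addgt0Pl => e e0; rewrite addr0; apply: h.
Qed.
End Norm.

Section ScalarNorm.
Variables (R : realType).
Implicit Types a b : R[i].

Lemma nmM a b : nm (a * b) = nm a * nm b.
Proof. by apply: (@complexI R); rewrite rmorphM /= -!nmE normrM. Qed.

Lemma nm1 : nm (1 : R[i]) = 1.
Proof. by rewrite /nm normr1. Qed.

Lemma nmV a : nm a^-1 = (nm a)^-1.
Proof. by apply: (@complexI R); rewrite fmorphV /= -!nmE normfV. Qed.

Lemma nmX a n : nm (a ^+ n) = nm a ^+ n.
Proof. by elim: n => [|n IH]; rewrite ?expr0 ?nm1 // !exprS nmM IH. Qed.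

Lemma nm_real (r : R) : nm r%:C = `|r|.
Proof.
apply: (@complexI R); rewrite -nmE normc_def /= expr0n /= addr0.
by rewrite sqrtr_sqr.
Qed.

Lemma nmZ (V : normedModType R[i]) a (x : V) : nm (a *: x) = nm a * nm x.
Proof. by apply: (@complexI R); rewrite rmorphM /= -!nmE normrZ. Qed.

Lemma nm_le_ReIm a : nm a <= `|complex.Re a| + `|complex.Im a|.
Proof.
have {1}-> : a = (complex.Re a)%:C + 'i%C * (complex.Im a)%:C by exact: complexE.
apply: le_trans (nmD _ _) _; rewrite nmM !nm_real.
suff -> : nm ('i%C : R[i]) = 1 by rewrite mul1r.
by rewrite /nm normc_def /= expr0n /= expr1n add0r sqrtr1.
Qed.

Lemma Re_le_nm a : `|complex.Re a| <= nm a.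
Proof. by rewrite -lecR -nmE normc_ge_Re. Qed.

Lemma Im_le_nm a : `|complex.Im a| <= nm a.
Proof.
have -> : nm a = nm (a * 'i%C).
  suff -> : nm (a * 'i%C) = nm a * 1 by rewrite mulr1.
  by rewrite nmM {2}/nm normc_def /= expr0n /= expr1n add0r sqrtr1.
by rewrite -normrN -ReiNIm Re_le_nm.
Qed.
End ScalarNorm.

Lemma exprn_small (R : realType) (q c e : R) : 0 <= q < 1 -> 0 < e ->
  exists N, forall n, (N <= n)%N -> c * q ^+ n < e.
Proof.
move=> /andP[q0 q1] e0; have := @cvg_geometric R c q.
rewrite ger0_norm // => /(_ q1) /cvgrPdist_lt /(_ _ e0) [N _ HN].
exists N => n Nn; have := HN n Nn; rewrite /= sub0r normrN /geometric /=.
exact: le_lt_trans (ler_norm _).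
Qed.

Lemma cauchy_limit (R : realType) (X : completeNormedModType R[i])
  (u : nat -> X) (b : nat -> R) :
  (forall n m, (n <= m)%N -> nm (u m - u n) <= b n) ->
  (forall e, 0 < e -> exists n, b n < e) ->
  exists l, forall n, nm (l - u n) <= b n.
Proof.
move=> ub b0.
have uc : cvg (u @ \oo).
  apply/cauchy_cvgP; apply/cauchy_ballP => e e0.
  have e0R : 0 < complex.Re e by move: e0; rewrite ltcE /= => /andP[].
  have eE : e = (complex.Re e)%:C by rewrite RRe_real // gtr0_real.
  have [N bN] := b0 (complex.Re e / 2) ltac:(lra).
  exists ([set x | nm (x - u N) <= b N], [set x | nm (x - u N) <= b N]).
    by split; exists N => // n /= Nn; apply: ub.
  move=> [x y] [/= xN yN]; rewrite -ball_normE /ball_ /= nmE eE ltcR.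
  by have := nm_tri (u N) x y; rewrite (nmBC (u N)); lra.
exists (lim (u @ \oo)) => n; apply/ler_addgt0Pr => e e0.
have eC : 0 < e%:C by rewrite ltcR.
move/cvgrPdist_lt: uc => /(_ _ eC) [N _ /(_ (maxn n N) (leq_maxr _ _))] /=.
rewrite nmE ltcR => h; have := ub n (maxn n N) (leq_maxl _ _).
by have := nm_tri (u (maxn n N)) (lim (u @ \oo)) (u n); lra.
Qed.

Lemma geometric_cauchy (R : realType) (V : normedZmodType R[i])
  (u : nat -> V) (c q : R) : 0 <= q < 1 ->
  (forall n, nm (u n.+1 - u n) <= c * q ^+ n) ->
  forall n m, (n <= m)%N -> nm (u m - u n) <= c / (1 - q) * q ^+ n.
Proof.
move=> q01 hu n m nm_; have c0 : 0 <= c.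
  by have := hu 0%N; rewrite expr0 mulr1; apply: le_trans (nm_ge0 _).
have q1 : 0 < 1 - q by move: q01 => /andP[_]; lra.
(* Keeping the term [q ^+ m] makes the bound telescope, so that the induction on [m - n] closes. *)
have : nm (u m - u n) <= c / (1 - q) * (q ^+ n - q ^+ m).
  rewrite -(subnKC nm_); elim: (m - n)%N => [|k IH].
    by rewrite addn0 !subrr mulr0 nm0.
  rewrite addnS; apply: le_trans (nm_tri (u (n + k)%N) _ _) _.
  have := hu (n + k)%N; rewrite exprS.
  have -> : c * q ^+ (n + k) = c / (1 - q) * (q ^+ (n + k) - q * q ^+ (n + k)).
    by field; rewrite gt_eqF.
  lra.
move=> /le_trans; apply; apply: ler_wpM2l; first by rewrite divr_ge0 // ltW.
by rewrite gerBl exprn_ge0 //; case/andP: q01.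
Qed.

Lemma series_limit (R : realType) (X : completeNormedModType R[i])
  (u : nat -> X) (c q : R) : 0 <= q < 1 ->
  (forall n, nm (u n.+1 - u n) <= c * q ^+ n) ->
  exists l, forall n, nm (l - u n) <= c / (1 - q) * q ^+ n.
Proof.
move=> q01 hu; apply: cauchy_limit; first exact: geometric_cauchy.
move=> e e0; have [N HN] := exprn_small (c / (1 - q)) q01 e0.
by exists N; apply: HN.
Qed.

(** The limit is the supremum of the levels [r] that lie below [f] on a set of [U]; an ultrafilter
    decides every level, so [f] stays below any level above the supremum on a set of [U]. *)
Lemma ultra_lim_real (R : realType) (I : Type) (U : set_system I)
  (UU : UltraFilter U) (f : I -> R) (c : R) : (forall i, `|f i| <= c) ->
  exists l, forall e, 0 < e -> U [set i | `|f i - l| < e].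
Proof.
move=> fc; pose E := [set r | U [set i | r <= f i]].
have Ec : E (- c).
  by apply: filterS filterT => i _ /=; have := fc i; rewrite ler_norml => /andP[].
have hE : has_sup E.
  split; first by exists (- c).
  exists c => r Er; have [i /= ri] := filter_ex Er.
  exact: le_trans ri (le_trans (ler_norm _) (fc i)).
exists (sup E) => e e0; have [r Er rE] := sup_adherent e0 hE.
have [h|h] := in_ultra_setVsetC [set i | sup E + e / 2 <= f i] UU.
  by have := sup_upper_bound hE h; lra.
apply: filterS (filterI Er h) => i /= [ri /negP]; rewrite -ltNge => hi.
by rewrite ltr_norml; apply/andP; split; lra.
Qed.

Definition ulim (R : realType) (I : Type) (U : set_system I) (f : I -> R[i])
  (l : R[i]) := forall e : R, 0 < e -> U [set i | nm (f i - l) < e].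

Lemma ultra_lim (R : realType) (I : Type) (U : set_system I)
  (UU : UltraFilter U) (f : I -> R[i]) (c : R) : (forall i, nm (f i) <= c) ->
  exists l, ulim U f l.
Proof.
move=> fc.
have [a Ha] := ultra_lim_real UU (fun i => le_trans (Re_le_nm (f i)) (fc i)).
have [b Hb] := ultra_lim_real UU (fun i => le_trans (Im_le_nm (f i)) (fc i)).
exists (a +i* b) => e e0.
have e2 : 0 < e / 2 by lra.
apply: filterS (filterI (Ha _ e2) (Hb _ e2)) => i /= [hi1 hi2].
apply: le_lt_trans (nm_le_ReIm _) _.
have -> : complex.Re (f i - (a +i* b)) = complex.Re (f i) - a by case: (f i).
have -> : complex.Im (f i - (a +i* b)) = complex.Im (f i) - b by case: (f i).
lra.
Qed.

Section Ulim.
Variables (R : realType) (I : Type) (U : set_system I).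
Hypothesis UU : ProperFilter U.
Implicit Types (f g : I -> R[i]).

Lemma ulimD f g l m : ulim U f l -> ulim U g m ->
  ulim U (fun i => f i + g i) (l + m).
Proof.
move=> hf hg e e0; have e2 : 0 < e / 2 by lra.
apply: filterS (filterI (hf _ e2) (hg _ e2)) => i /= [h1 h2].
have -> : f i + g i - (l + m) = (f i - l) + (g i - m) by ring.
by apply: le_lt_trans (nmD _ _) _; lra.
Qed.

Lemma ulimZ a f l : ulim U f l -> ulim U (fun i => a * f i) (a * l).
Proof.
move=> hf e e0.
have h : 0 < e / (nm a + 1).
  by apply: divr_gt0 => //; have := nm_ge0 a; lra.
apply: filterS (hf _ h) => i /=; rewrite -mulrBr nmM ltr_pdivlMr; last first.
  by have := nm_ge0 a; lra.
by have := nm_ge0 (f i - l); lra.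
Qed.

Lemma ulim_ext f g l : (forall i, f i = g i) -> ulim U f l -> ulim U g l.
Proof. by move=> fg; have -> : f = g by apply/funext. Qed.
End Ulim.

(** Completeness of the scalars: the limit along an ultrafilter finer than [\oo] inherits the tail
    estimates. *)
Lemma scalar_limit (R : realType) (u : nat -> R[i]) (c q : R) : 0 <= q < 1 ->
  (forall n, nm (u n.+1 - u n) <= c * q ^+ n) ->
  exists l, forall n, nm (l - u n) <= c / (1 - q) * q ^+ n.
Proof.
move=> q01 hu; have hnm := geometric_cauchy q01 hu.
have [U [UU sU]] := @ultraFilterLemma nat \oo _.
have [l hl] := @ultra_lim R nat U UU u (nm (u 0%N) + c / (1 - q))
   (fun n => ltac:(have := hnm 0%N n (leq0n n); have := nm_sub (u n) (u 0%N);
     rewrite expr0 mulr1; lra)).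
exists l => n; apply/ler_addgt0Pr => e e0.
have Un : U [set m | (n <= m)%N] by apply: sU; exists n.
have [m /= [nm_ lm]] := filter_ex (filterI Un (hl _ e0)).
by have := nm_tri (u m) l (u n); rewrite (nmBC l (u m)); have := hnm n m nm_; lra.
Qed.

Section Bounded.
Variables (R : realType) (X : normedModType R[i]).

Lemma continuous_bdd (T : {linear X -> X}) : continuous T ->
  exists2 c : R, 0 <= c & forall x, nm (T x) <= c * nm x.
Proof.
move=> /(_ 0) cT; have := @continuous_linear_bounded _ _ _ 0 T cT.
move=> /linear_boundedP/pinfty_ex_gt0 [r r0 h].
have eE : r = (complex.Re r)%:C by rewrite RRe_real // gtr0_real.
exists (complex.Re r); first by apply: ltW; rewrite -ltcR -eE.
by move=> x; rewrite -lecR rmorphM /= -!nmE -eE; apply: h.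
Qed.

Lemma bdd_continuous (Y : normedModType R[i]) (T : {linear X -> Y}) (c : R) :
  (forall x, nm (T x) <= c * nm x) -> continuous T.
Proof.
move=> h; apply: bounded_linear_continuous; apply/linear_boundedP.
apply: (@filterS _ _ _ (fun r : R[i] => c%:C <= r)); last first.
  by apply: nbhs_pinfty_ge; apply/complex_realP; exists c.
move=> r cr x; apply: le_trans (_ : c%:C * `|x| <= _).
  by rewrite !nmE -rmorphM lecR.
by apply: ler_wpM2r.
Qed.

Definition eclosed (L : set X) :=
  forall x, (forall e : R, 0 < e -> exists2 y, L y & nm (x - y) < e) -> L x.

Lemma eclosed_closed (L : set X) : eclosed L -> closed L.
Proof.
move=> h x cx; apply: h => e e0.
have eC : 0 < e%:C by rewrite ltcR.
have [y [Ly]] := cx _ (nbhsx_ballx x _ eC).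
by rewrite -ball_normE /= nmE ltcR; exists y.
Qed.
End Bounded.

Section NearNorm.
Variables (R : realType) (X : normedModType R[i]).

(** Here [s] is the norm of [p] on [Y], and [w] attains it up to a tenth; [w0] makes the supremum
    positive, so that a tenth of it can be given away. *)
Lemma near_norm (Y : set X) (p : X -> R) (C : R) (w0 : X) :
  (forall a x, Y x -> Y (a *: x)) -> (forall a x, p (a *: x) = nm a * p x) ->
  (forall x, Y x -> p x <= C * nm x) -> Y w0 -> nm w0 <= 1 -> 0 < p w0 ->
  exists s, [/\ p w0 <= s, forall x, Y x -> p x <= s * nm x &
    exists w, [/\ Y w, nm w <= 1 & s * (9 / 10) <= p w]].
Proof.
move=> YZ pZ pC Yw w1 p0; pose E := [set p w | w in [set w | Y w /\ nm w <= 1]].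
have C0 : 0 <= C.
  by have := pC _ Yw; have := nm_ge0 w0 => h1 h2; nra.
have hE : has_sup E.
  split; first by exists (p w0), w0.
  exists C => _ [w [Yw' ww] <-]; apply: le_trans (pC _ Yw') _; nra.
have s0 : p w0 <= sup E by apply: sup_upper_bound => //; exists w0.
exists (sup E); split => //.
  move=> x Yx; have [->|x0] := eqVneq x 0.
    by have := pZ 0 (0 : X); rewrite scale0r !nm0 mul0r mulr0 => ->.
  have nx : 0 < nm x by rewrite nm_gt0.
  suff : p ((nm x)^-1%:C *: x) <= sup E.
    rewrite pZ nm_real ger0_norm ?invr_ge0 ?nm_ge0 //.
    by rewrite ler_pdivrMl // mulrC.
  apply: sup_upper_bound => //; exists ((nm x)^-1%:C *: x) => //; split; first exact: YZ.
  by rewrite nmZ nm_real ger0_norm ?invr_ge0 ?nm_ge0 // mulVf // gt_eqF.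
have s1 : 0 < sup E / 10 by lra.
have [_ [w [Yw' ww] <-] hw] := sup_adherent s1 hE.
by exists w; split => //; lra.
Qed.

End NearNorm.

(** * Uniform boundedness and the Hahn-Banach theorem *)

(** Uniform boundedness without Baire category, in quantitative form. Since [p n (x + t w) + p n (t
    w - x) >= 2 p n (t w)], one of the moves [x + t w_n], [x - t w_n] of size [3^-n] makes [p n] at
    least [9/10 C n 3^-n]. All later moves together have length at most [3^-n / 2], and
    [9/10 - 1/2 = 2/5]. *)
Lemma gliding_hump (R : realType) (X : completeNormedModType R[i])
  (p : nat -> X -> R) (C : nat -> R) (w : nat -> X) :
  (forall n x y, p n (x + y) <= p n x + p n y) ->
  (forall n a x, p n (a *: x) = nm a * p n x) ->
  (forall n x, p n x <= C n * nm x) ->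
  (forall n, nm (w n) <= 1) -> (forall n, C n * (9 / 10) <= p n (w n)) ->
  exists x, forall n, C n * 3^-1 ^+ n * (2 / 5) <= p n x.
Proof.
move=> pD pZ pC w1 hw.
have pN n x : p n (- x) = p n x by rewrite -scaleN1r pZ nmN nm1 mul1r.
have step n x : exists t : R[i], nm t = 3^-1 ^+ n /\
    3^-1 ^+ n * (C n * (9/10)) <= p n (x + t *: w n).
  have r0 : 0 <= (3^-1 : R) ^+ n by apply: exprn_ge0; lra.
  pose t := ((3^-1 : R) ^+ n)%:C.
  have nt : nm t = 3^-1 ^+ n by rewrite nm_real ger0_norm.
  have h : 3^-1 ^+ n * (C n * (9/10)) <= p n (t *: w n).
    by rewrite pZ nt; apply: ler_wpM2l.
  have := pD n (x + t *: w n) (t *: w n - x).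
  have -> : x + t *: w n + (t *: w n - x) = 2 *: (t *: w n).
    by rewrite addrC addrA subrK scaler_nat mulr2n.
  have n2 : nm (2 : R[i]) = 2.
    by rewrite -(rmorph_nat (real_complex R)) nm_real ger0_norm.
  rewrite pZ n2 => h2.
  have [h3|h3] := leP (3^-1 ^+ n * (C n * (9/10))) (p n (x + t *: w n)).
    by exists t.
  exists (- t); split; first by rewrite nmN.
  by rewrite scaleNr -pN opprB; lra.
pose f n x := x + xget 0 [set t : R[i] | nm t = 3^-1 ^+ n /\
    3^-1 ^+ n * (C n * (9/10)) <= p n (x + t *: w n)] *: w n.
pose u := fix u n := if n is m.+1 then f m (u m) else 0 : X.
have uS n : nm (u n.+1 - u n) <= 1 * 3^-1 ^+ n /\
    3^-1 ^+ n * (C n * (9/10)) <= p n (u n.+1).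
  rewrite /= /f; case: xgetP => [t -> [nt ht]|h]; last first.
    by have [t ht] := step n (u n); case: (h t).
  split => //; rewrite addrC addKr nmZ nt mul1r.
  have := w1 n; have : 0 <= (3^-1 : R) ^+ n by apply: exprn_ge0; lra.
  by have := nm_ge0 (w n); nra.
have q01 : 0 <= (3^-1 : R) < 1 by lra.
have [l hl] := series_limit q01 (fun n => proj1 (uS n)).
exists l => n; have [_ h] := uS n; have := hl n.+1; rewrite exprS.
have r0 : 0 < (3^-1 : R) ^+ n by apply: exprn_gt0; lra.
have p0 : 0 <= p n l.
  have := pD n l (- l); rewrite subrr pN.
  by have := pZ n 0 0; rewrite scale0r nm0 mul0r => ->; lra.
have [Cn0|Cn0] := ltP (C n) 0; first by nra.
have := pD n l (u n.+1 - l); rewrite addrC subrK -(pN n (_ - l)) opprB.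
move=> h1 h2; have h3 := pC n (l - u n.+1).
have e : 1 / (1 - 3^-1) = 3 / 2 :> R by field; lra.
rewrite e in h2; nra.
Qed.

Section HahnBanach.
Variables (R : realType) (X : lmodType R[i]) (q : X -> R).
Hypothesis qD : forall x y, q (x + y) <= q x + q y.
Hypothesis qZ : forall a x, q (a *: x) = nm a * q x.

(* A partial real-linear functional is encoded by its graph: domination by the
   seminorm [q] already forces the graph to be single valued. *)
Let dominated (x0 : X) (G : set (X * R)) :=
  [/\ forall p, G p -> G (x0, q x0),
      forall p p', G p -> G p' -> G (p.1 + p'.1, p.2 + p'.2),
      forall (t : R) p, G p -> G (t%:C *: p.1, t * p.2) &
      forall p, G p -> p.2 <= q p.1].

Let qZr (t : R) x : 0 <= t -> q (t%:C *: x) = t * q x.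
Proof. by move=> t0; rewrite qZ nm_real ger0_norm. Qed.

Let qN x : q (- x) = q x.
Proof. by rewrite -scaleN1r qZ nmN nm1 mul1r. Qed.

Let q_ge0 x : 0 <= q x.
Proof.
have := qD x (- x); rewrite subrr qN.
by have := qZ 0 0; rewrite scale0r nm0 mul0r => ->; lra.
Qed.

(** The value at [x] may lie anywhere between the numbers [r - q (y - x)] and the numbers
    [q (z + x) - s]; subadditivity applied to [(y - x) + (z + x)] keeps the two families ordered,
    and the supremum of the first one is taken. *)
Let dominated_extend x0 G x : dominated x0 G -> G (x0, q x0) ->
  exists G', [/\ dominated x0 G', G `<=` G' & exists r, G' (x, r)].
Proof.
move=> [G0 GD GZ Gq] Gx0.
have key y r z s : G (y, r) -> G (z, s) -> r - q (y - x) <= q (z + x) - s.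
  move=> Gy Gz; have /= := Gq _ (GD _ _ Gy Gz).
  have := qD (y - x) (z + x).
  have -> : y - x + (z + x) = y + z by rewrite addrCA subrK addrC.
  lra.
pose E := [set t | exists y r, G (y, r) /\ t = r - q (y - x)].
have hE : has_sup E.
  split; first by exists (q x0 - q (x0 - x)), x0, (q x0).
  by exists (q (x0 + x) - q x0) => _ [y [r [Gy ->]]]; apply: key.
pose al := sup E.
have al1 y r : G (y, r) -> r - q (y - x) <= al.
  by move=> Gy; apply: sup_upper_bound => //; exists y, r.
have al2 z s : G (z, s) -> al <= q (z + x) - s.
  move=> Gz; apply: ge_sup; first by case: hE.
  by move=> _ [y [r [Gy ->]]]; apply: key.
exists [set p | exists y r (t : R),
  [/\ G (y, r), p.1 = y + t%:C *: x & p.2 = r + t * al]]; split; last first.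
- exists al => /=; exists 0, 0, 1.
  rewrite scale1r add0r add0r mul1r; split => //.
  by have := GZ 0 _ Gx0; rewrite /= scale0r mul0r.
- move=> [y r] Gy /=; exists y, r, 0.
  by rewrite scale0r mul0r !addr0.
split.
- move=> _ _; exists x0, (q x0), 0; by rewrite scale0r mul0r !addr0.
- move=> p p' [y [r [t [Gy -> ->]]]] [y' [r' [t' [Gy' -> ->]]]].
  exists (y + y'), (r + r'), (t + t'); split => /=.
  + exact: GD Gy Gy'.
  + by rewrite rmorphD scalerDl addrACA.
  + ring.
- move=> s p [y [r [t [Gy -> ->]]]].
  exists (s%:C *: y), (s * r), (s * t); split => /=.
  + exact: GZ Gy.
  + by rewrite rmorphM scalerDr scalerA.
  + ring.
move=> [z s] [y [r [t [Gy /= -> ->]]]].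
have [t0|t0|->] := ltgtP t 0; last first.
- by rewrite scale0r mul0r !addr0; apply: Gq Gy.
- have := al2 _ _ (GZ t^-1 _ Gy) => /=.
  have -> : y + t%:C *: x = t%:C *: ((t^-1)%:C *: y + x).
    by rewrite scalerDr scalerA -rmorphM /= divff ?gt_eqF // scale1r.
  rewrite (qZr _ (ltW t0)) => h.
  have -> : r = t * (t^-1 * r) by rewrite mulrA divff ?gt_eqF // mul1r.
  by rewrite -mulrDr ler_pM2l //; lra.
- pose u := - t; have u0 : 0 < u by rewrite oppr_gt0.
  have -> : t = - u by rewrite opprK.
  have := al1 _ _ (GZ u^-1 _ Gy) => /=.
  have -> : y + (- u)%:C *: x = u%:C *: ((u^-1)%:C *: y - x).
    by rewrite scalerBr scalerA -rmorphM /= divff ?gt_eqF // scale1r rmorphN scaleNr.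
  rewrite (qZr _ (ltW u0)) => h.
  have -> : r = u * (u^-1 * r) by rewrite mulrA divff ?gt_eqF // mul1r.
  by have := ler_wpM2l (ltW u0) h; lra.
Qed.

Theorem hahn_banach_seminorm (x0 : X) : exists f : X -> R[i],
  [/\ scalar f, forall x, nm (f x) <= q x & q x0 <= nm (f x0)].
Proof.
have [|G [[G0 GD GZ Gq] Gmax]] := @Zorn_bigcup (X * R)%type (dominated x0).
  move=> F FP Ftot; split.
  - by move=> p [G FG Gp]; exists G => //; have [h _ _ _] := FP _ FG; apply: h Gp.
  - move=> p p' [G FG Gp] [G' FG' Gp'].
    have [s|s] := Ftot _ _ FG FG'.
      by exists G' => //; have [_ h _ _] := FP _ FG'; apply: h => //; apply: s.
    by exists G => //; have [_ h _ _] := FP _ FG; apply: h => //; apply: s.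
  - by move=> t p [G FG Gp]; exists G => //; have [_ _ h _] := FP _ FG; apply: h.
  - by move=> p [G FG Gp]; have [_ _ _ h] := FP _ FG; apply: h.
(* The empty graph is dominated too, which covers the empty chain in Zorn's lemma; a maximal graph
   is nonempty because the line through [x0] would extend the empty one. *)
have Gx0 : G (x0, q x0).
  have [//|nG] := pselect (G (x0, q x0)).
  pose L := [set p : X * R | exists t : R, p = (t%:C *: x0, t * q x0)].
  case: (Gmax L).
    split; first by move=> p /G0.
    by move=> LG; apply: nG; apply: LG; exists 1; rewrite scale1r mul1r.
  split.
  - by move=> _ _; exists 1; rewrite scale1r mul1r.
  - move=> p p' [t ->] [t' ->]; exists (t + t') => /=.
    by rewrite rmorphD scalerDl mulrDl.
  - move=> s p [t ->]; exists (s * t) => /=.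
    by rewrite rmorphM scalerA mulrA.
  - move=> p [t ->] /=; rewrite qZ nm_real.
    by apply: ler_wpM2r => //; apply: ler_norm.
have Gtot x : exists r, G (x, r).
  have [G' [dG' sG [r G'x]]] := dominated_extend x (And4 G0 GD GZ Gq) Gx0.
  have [//|nG] := pselect (exists r, G (x, r)); case: (Gmax G') => //.
  by split => // h; apply: nG; exists r; apply: h.
pose u x := xget 0 [set r | G (x, r)].
have Gu x : G (x, u x).
  by rewrite /u; case: xgetP => [r -> //|h]; have [r /h] := Gtot x.
have Guniq x r s : G (x, r) -> G (x, s) -> r = s.
  move=> Gr Gs.
  have h a b : G (x, a) -> G (x, b) -> a <= b.
    move=> Ga Gb; have := Gq _ (GD _ _ Ga (GZ (-1) _ Gb)) => /=.
    rewrite rmorphN1 scaleN1r subrr.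
    by have := qZ 0 0; rewrite scale0r nm0 mul0r => ->; lra.
  by apply/eqP; rewrite eq_le !h.
have uD x y : u (x + y) = u x + u y by apply: Guniq (Gu _) (GD _ _ (Gu x) (Gu y)).
have uZ (t : R) x : u (t%:C *: x) = t * u x.
  exact: Guniq (Gu _) (GZ t _ (Gu x)).
have uq x : u x <= q x by apply: Gq (Gu x).
(* The unique complex linear functional with real part [u]. *)
pose f x : R[i] := u x +i* (- u ('i%C *: x)).
have fZ a x : f (a *: x) = a * f x.
  case: a => a b; have -> : (a +i* b) = a%:C + b%:C * 'i%C :> R[i].
    by apply/eqP; rewrite eq_complex /=; apply/andP; split; apply/eqP; ring.
  rewrite scalerDl -[X in _ + X]scalerA /f uD !uZ scalerDr uD.
  rewrite [X in u (X) + _]scalerA (mulrC 'i%C) -scalerA uZ.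
  have -> : 'i%C *: (b%:C *: ('i%C *: x)) = (- b)%:C *: x.
    by rewrite !scalerA mulrAC -expr2 sqr_i mulN1r rmorphN.
  by rewrite uZ; apply/eqP; rewrite eq_complex /=; apply/andP; split; apply/eqP; ring.
exists f; split.
- move=> a x y; rewrite -fZ /f uD scalerDr uD.
  by apply/eqP; rewrite eq_complex /= opprD !eqxx.
- move=> x; have [->|f0] := eqVneq (f x) 0; first by rewrite nm0.
  (* Rotating [x] by this unit scalar makes the value of [f] real and nonnegative, so the bound on
     [u] bounds the modulus. *)
  pose th := (nm (f x))%:C / f x.
  have nth : nm th = 1.
    by rewrite nmM nmV nm_real ger0_norm ?nm_ge0 // divff // nm_eq0.
  have : f (th *: x) = (nm (f x))%:C by rewrite fZ divfK.
  move=> [ux _]; rewrite -ux.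
  by apply: le_trans (uq _) _; rewrite qZ nth mul1r.
- apply: le_trans (Re_le_nm (f x0)) => /=.
  by rewrite (Guniq _ _ _ (Gu x0) Gx0) ler_norm.
Qed.
End HahnBanach.

(** * Extraction of triangular systems *)

Section ScalarTheory.
Variables (R : realType) (W : lmodType R[i]) (f : W -> R[i]).
Hypothesis fl : scalar f.

Lemma scalar_0 : f 0 = 0.
Proof.
have := fl 1 0 0; rewrite scale1r addr0 mul1r => /eqP.
by rewrite -subr_eq0 opprD addNKr oppr_eq0 => /eqP.
Qed.

Lemma scalar_D x y : f (x + y) = f x + f y.
Proof. by have := fl 1 x y; rewrite scale1r mul1r. Qed.

Lemma scalar_Z a x : f (a *: x) = a * f x.
Proof. by have := fl a x 0; rewrite !addr0 scalar_0 addr0. Qed.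

Lemma scalar_N x : f (- x) = - f x.
Proof. by rewrite -scaleN1r scalar_Z mulN1r. Qed.

Lemma scalar_B x y : f (x - y) = f x - f y.
Proof. by rewrite scalar_D scalar_N. Qed.

Lemma scalar_sum n (a : 'I_n -> R[i]) (v : 'I_n -> W) :
  f (\sum_i a i *: v i) = \sum_i a i * f (v i).
Proof.
elim/big_ind2: _ => //; first exact: scalar_0.
- by move=> x y z t <- <-; rewrite scalar_D.
- by move=> i _; rewrite scalar_Z.
Qed.
End ScalarTheory.

Section Triangular.
Variables (R : realType) (W : lmodType R[i]) (I : Type) (U : set_system I).
Hypothesis UU : UltraFilter U.
Let UP : ProperFilter U := ultra_proper.
(** [Bd w a] reads as norm at most [a] in a test space inside [W]. For eigenvectors the test space
    consists of the bounded functionals vanishing on [M], with [g i] the evaluation at [v i]; for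
    eigenfunctionals it is the subspace [Y] of [X]. A relation is used because members of [W]
    outside the test space need have no norm. *)
Variables (g : I -> W -> R[i]) (Bd : W -> R -> Prop) (c : I -> R[i]).
Hypothesis g_lin : forall i, scalar (g i).
Hypothesis BdD : forall w w' a b, Bd w a -> Bd w' b -> Bd (w + w') (a + b).
Hypothesis BdZ : forall t w a, Bd w a -> Bd (t *: w) (nm t * a).
Hypothesis BdW : forall w a b, Bd w a -> a <= b -> Bd w b.
Hypothesis gBd : forall i w a, Bd w a -> nm (g i w) <= a.
Hypothesis c0 : ulim U c 0.
Variable delta : R.
Hypothesis delta0 : 0 < delta.
Hypothesis not_cauchy : forall A, U A -> exists i j w,
  [/\ A i, A j, Bd w 1 & delta <= nm (g i w - g j w)].
Hypothesis complete : forall (u : nat -> W) (eta : R), u 0%N = 0 ->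
  (forall k, Bd (u k.+1 - u k) (eta * 2^-1 ^+ k.+1)) ->
  exists y, Bd y eta /\ forall i a,
    (exists N, forall k, (N <= k)%N -> g i (u k) = a) -> g i y = a.
Variable eta : R.
Hypothesis eta01 : 0 < eta <= 1.

(** The weak-star limit of the [g i] along [U]; the default 0 is taken where no limit exists, which
    never happens for bounded [w]. *)
Let gl w := xget 0 [set l | ulim U (g^~ w) l].

Let glP w a : Bd w a -> ulim U (g^~ w) (gl w).
Proof.
move=> Bw; rewrite /gl; case: xgetP => [l -> //|h].
by have [l /h] := ultra_lim UU (fun i => @gBd i w a Bw).
Qed.

Let gl_le w a : Bd w a -> nm (gl w) <= a.
Proof.
move=> Bw; apply/ler_addgt0Pr => e e0.
have [i /= hi] := filter_ex (glP Bw e0).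
by have := nm_sub (gl w) (g i w); have := gBd i Bw; rewrite nmBC; lra.
Qed.

(** [st_set] collects the pairs (index, dual vector) selected so far, the last of them being [st_i],
    [st_w]; [st_proj] maps into the common kernel of the selected functionals and of [gl], with norm
    at most [st_K]. *)
Record state := State {
  st_set : set (I * W); st_proj : W -> W; st_K : R; st_n : nat;
  st_i : I; st_w : W }.

(** The fourth clause says that composing [g i] with [P] amounts to subtracting [gl], up to an error
    small in norm for [U]-most [i]. The last one says that late functionals almost annihilate all
    dual vectors selected so far. *)
Let inv st :=
  let: State Ss P K _ _ _ := st in
  [/\ 1 <= K,
   (forall w a, Bd w a -> Bd (P w) (K * a)),
   (forall w a, Bd w a -> ulim U (g^~ (P w)) 0),
   (forall e, 0 < e -> U [set i | forall w, Bd w 1 ->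
      nm (g i (P w) - g i w + gl w) < e]) &
   (forall p, Ss p -> forall w, g p.1 (P w) = 0) /\
   (forall e, 0 < e -> U [set i | forall p, Ss p -> nm (g i p.2) < e])].

(** The new projection is [P] minus a rank one map; [4 * K / delta] bounds the new dual vector. *)
Let nextK K : R := K * (1 + 4 * K / delta).
(** Fixed before the next index is chosen, yet measured against [nextK], which bounds the dual
    vector to come: a correction of size [2 * tol] along that vector has norm at most
    [eta / 2 ^ (n + 1)], hence is summable. *)
Let tol st : R := eta / (4 * 2 ^+ st_n st * nextK (st_K st)).

Let next st st' := inv st ->
  [/\ inv st', st_n st' = (st_n st).+1,
     st_set st' = st_set st `|` [set (st_i st', st_w st')],
     st_K st' = nextK (st_K st) /\ nm (c (st_i st')) <= tol st &
     [/\ forall p, st_set st p -> nm (g (st_i st') p.2) <= tol st /\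
          g p.1 (st_w st') = 0,
       g (st_i st') (st_w st') = 1 & Bd (st_w st') (st_K st')]].

Let nextK_ge K : 1 <= K -> 1 <= nextK K /\ 4 * K / delta <= nextK K.
Proof.
move=> K1; rewrite /nextK; set t := 4 * K / delta.
have t0 : 0 <= t by rewrite divr_ge0 // ?(ltW delta0) //; lra.
by nra.
Qed.

(* Some index survives the projection: [g i - gl] stays away from 0 in norm,
   while [P] changes [g i - gl] only by a small amount. *)
Let step st : {st' | next st st'}.
Proof.
apply: cid; have [hinv|ninv] := pselect (inv st); last by exists st.
case: st hinv => Ss P K n i0 w0 hinv.
have [K1 BP P0 Papp [Skill Ssmall]] := hinv.
have [nK1 nK2] := nextK_ge K1.
have tol0 : 0 < tol (State Ss P K n i0 w0).
  apply: divr_gt0; first by case/andP: eta01.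
  apply: mulr_gt0; first by rewrite mulr_gt0 // exprn_gt0.
  by apply: lt_le_trans nK1.
set tau := tol _ in tol0.
(* Otherwise [U]-most [g i] would be within [delta / 2] of [gl] on the unit ball, and any two of
   them within [delta] of each other. *)
have hlow : U [set i | exists w, Bd w 1 /\ delta / 2 <= nm (g i w - gl w)].
  have [//|h] := in_ultra_setVsetC
    [set i | exists w, Bd w 1 /\ delta / 2 <= nm (g i w - gl w)] UU.
  have [i [j [w [Ai Aj Bw hd]]]] := not_cauchy h; exfalso.
  have hi : nm (g i w - gl w) < delta / 2.
    by rewrite ltNge; apply/negP => hh; apply: Ai; exists w.
  have hj : nm (g j w - gl w) < delta / 2.
    by rewrite ltNge; apply/negP => hh; apply: Aj; exists w.
  have := nm_tri (gl w) (g i w) (g j w).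
  by rewrite (nmBC (gl w) (g j w)); lra.
have hc : U [set i | nm (c i) < tau].
  by apply: filterS (c0 tol0) => i; rewrite /= subr0.
have d4 : 0 < delta / 4 by apply: divr_gt0.
have [i /= [[[[w [Bw hw]] hci] hS] /(_ w Bw) hP]] :=
  filter_ex (filterI (filterI (filterI hlow hc) (Ssmall _ tol0)) (Papp _ d4)).
have gPw : delta / 4 <= nm (g i (P w)).
  have := nm_sub (g i w - gl w) (g i (P w)); rewrite (nmBC (g i w - gl w) (g i (P w))).
  have -> : g i (P w) - (g i w - gl w) = g i (P w) - g i w + gl w by ring.
  lra.
pose z := g i (P w).
have z0 : 0 < nm z by apply: lt_le_trans gPw; lra.
pose wn := z^-1 *: P w.
have Bwn : Bd wn (4 * K / delta).
  have := BdZ z^-1 (BP _ _ Bw); rewrite mulr1 nmV => h; apply: (BdW h).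
  rewrite mulrC; have -> : 4 * K / delta = K * (delta / 4)^-1.
    by rewrite invf_div mulrA mulrAC mulrC mulrA.
  by apply: ler_wpM2l; [lra | rewrite lef_pV2 ?posrE //; lra].
have gwn j : g j wn = z^-1 * g j (P w) by rewrite (scalar_Z (g_lin j)).
have gwn1 : g i wn = 1 by rewrite gwn mulVf // -nm_gt0.
have gwn0 p : Ss p -> g p.1 wn = 0 by move=> Sp; rewrite gwn (Skill _ Sp) mulr0.
have ugwn : ulim U (g^~ wn) 0.
  have := ulimZ UP z^-1 (P0 _ _ Bw); rewrite mulr0 => hu; apply: (ulim_ext _ hu) => j.
  by rewrite gwn.
(* Removing the component along [wn] kills the new functional, as [g i wn = 1], and leaves the
   earlier ones killed, as they vanish on [wn]. *)
pose P' v := P v - g i (P v) *: wn.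
have gP' j v : g j (P' v) = g j (P v) - g i (P v) * g j wn.
  by rewrite (scalar_B (g_lin j)) (scalar_Z (g_lin j)).
exists (State (Ss `|` [set (i, wn)]) P' (nextK K) n.+1 i wn) => _; split => //.
- split => //.
  + move=> v a Bv; have Bv' := BP _ _ Bv.
    have := BdD Bv' (BdZ (- g i (P v)) Bwn); rewrite scaleNr nmN => h.
    apply: (BdW h); have := gBd i Bv' => h'.
    rewrite /nextK; have k0 : 0 <= 4 * K / delta.
      by rewrite divr_ge0 // ?(ltW delta0) //; lra.
    by have := ler_wpM2r k0 h'; lra.
  + move=> v a Bv; have := ulimD UP (P0 _ _ Bv) (ulimZ UP (- g i (P v)) ugwn).
    rewrite mulr0 addr0 => hu; apply: (ulim_ext _ hu) => j.
    by rewrite gP' mulNr.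
  + move=> e e0; have e2 : 0 < e / 2 by lra.
    have eK : 0 < e / 2 / K by apply: divr_gt0 => //; lra.
    apply: filterS (filterI (Papp _ e2) (ugwn _ eK)) => j /= [h1 h2] v Bv.
    have := h1 v Bv; rewrite gP'.
    have -> : g j (P v) - g i (P v) * g j wn - g j v + gl v
            = g j (P v) - g j v + gl v - g i (P v) * g j wn by ring.
    have := nmB (g j (P v) - g j v + gl v) (g i (P v) * g j wn).
    rewrite nmM; have := gBd i (BP _ _ Bv); rewrite mulr1 => h3.
    move: h2; rewrite subr0 ltr_pdivlMr; last by lra.
    by have := nm_ge0 (g j wn); nra.
  + split.
      move=> p [Sp|->] v /=; rewrite gP'.
        by rewrite (Skill _ Sp) gwn0 // mulr0 subr0.
      by rewrite gwn1 mulr1 subrr.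
    move=> e e0; apply: filterS (filterI (Ssmall _ e0) (ugwn _ e0)) => j /=.
    by move=> [h1 h2] p [Sp|->] /=; [apply: h1|move: h2; rewrite subr0].
- by split => //; apply: ltW.
- split => //; last by apply: (BdW Bwn).
  by move=> p Sp; split; [apply/ltW/hS|apply: gwn0].
Qed.

(** The initial projection has to kill [gl]: it is the identity if [gl = 0], and otherwise the
    projection onto the kernel of [gl] along some [u] with [gl u != 0]. *)
Let init : exists st, inv st /\ st_n st = 0%N.
Proof.
have [i0 [_ [w0 _]]] := not_cauchy filterT.
have [h|h] := pselect (forall w a, Bd w a -> gl w = 0).
  exists (State set0 id 1 0 i0 w0); split => //; split => //.
  - by move=> w a; rewrite mul1r.
  - by move=> w a Bw; rewrite -(h _ _ Bw); apply: glP Bw.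
  - move=> e e0; apply: filterS filterT => i _ w Bw.
    by rewrite subrr add0r (h _ _ Bw) nm0.
  by split => // e e0; apply: filterS filterT => i _ p [].
have {h}[u [a [Bu gu]]] : exists u a, Bd u a /\ gl u != 0.
  apply: contrapT => hh; apply: h => w a Bw; apply/eqP/negP => /negP gw.
  by apply: hh; exists w, a.
have gu0 : 0 < nm (gl u) by rewrite nm_gt0.
pose P w := w - (gl w / gl u) *: u.
have a0 : 0 <= a by apply: le_trans (gl_le Bu); apply: nm_ge0.
have gP i w : g i (P w) = g i w - (gl w / gl u) * g i u.
  by rewrite (scalar_B (g_lin i)) (scalar_Z (g_lin i)).
have k0 : 0 <= a / nm (gl u) by rewrite divr_ge0 // ltW.
exists (State set0 P (1 + a / nm (gl u)) 0 i0 w0); split => //; split.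
- lra.
- move=> w b Bw; have := BdD Bw (BdZ (- (gl w / gl u)) Bu).
  rewrite scaleNr nmN nmM nmV => h; apply: (BdW h); have := gl_le Bw => h'.
  by have := ler_wpM2r k0 h'; rewrite mulrDl mul1r [in X in _ -> X]mulrAC; lra.
- move=> w b Bw; have := ulimD UP (glP Bw) (ulimZ UP (- (gl w / gl u)) (glP Bu)).
  rewrite mulNr divfK // subrr => hu; apply: (ulim_ext _ hu) => j.
  by rewrite gP mulNr.
- move=> e e0; have e1 : 0 < e * nm (gl u) by rewrite mulr_gt0.
  apply: filterS (glP Bu e1) => j /= h w Bw.
  have -> : g j (P w) - g j w + gl w = - (gl w * (g j u - gl u) / gl u).
    by rewrite gP; field.
  rewrite nmN !nmM nmV ltr_pdivrMr //; have := gl_le Bw => h1.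
  by have := nm_ge0 (g j u - gl u); nra.
by split => // e e0; apply: filterS filterT => i _ p [].
Qed.

(** Forward substitution: the dual vector [w n] is killed by all earlier functionals, so the
    correction made at step [n] leaves the equations already solved intact. *)
Lemma triangular_system : exists (i : nat -> I) (eps : nat -> R),
  [/\ forall k, 0 < eps k, forall k, nm (c (i k)) <= eps k &
    forall b : nat -> R[i], (forall k, nm (b k) <= eps k) ->
      exists y, Bd y eta /\ forall k, g (i k) y = b k].
Proof.
have [st0 [inv0 n0]] := init.
have [s [s0 snext]] := dependent_choice step st0.
have sinv n : inv (s n).
  by elim: n => [|n IH]; [rewrite s0|have [] := snext n IH].
have sn n : st_n (s n) = n.
  by elim: n => [|n IH]; [rewrite s0|have [_ -> _ _ _] := snext n (sinv n); rewrite IH].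
pose i n := st_i (s n.+1); pose w n := st_w (s n.+1).
pose eps n := tol (s n); pose K n := st_K (s n.+1).
have sS n j : (j < n)%N -> st_set (s n) (i j, w j).
  elim: n => // n IH; rewrite ltnS leq_eqVlt.
  have [_ _ -> _ _] := snext n (sinv n).
  by case/orP => [/eqP ->|/IH h]; [right|left].
have K1 n : 1 <= K n by have := sinv n.+1; rewrite /K; case: (s n.+1) => ????? ? [].
have epsE n : eps n = eta / (4 * 2 ^+ n * K n).
  by have [_ _ _ [KE _] _] := snext n (sinv n); rewrite /K KE /eps /tol sn.
have eps0 n : 0 < eps n.
  rewrite epsE; apply: divr_gt0; first by case/andP: eta01.
  by rewrite !mulr_gt0 // ?exprn_gt0 //; have := K1 n; lra.
have two n : 0 < (2 : R) ^+ n by apply: exprn_gt0.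
have epsK n : 2 * eps n * K n = eta * 2^-1 ^+ n.+1.
  rewrite epsE exprS exprVn; field.
  by rewrite !gt_eqF //; have := K1 n; lra.
have eps2 n : 2 * eps n <= 2^-1 ^+ n.+1.
  apply: le_trans (_ : 2 * eps n * K n <= _).
    by have := K1 n; have := eps0 n; nra.
  rewrite epsK; have : 0 <= (2^-1 : R) ^+ n.+1 by apply: exprn_ge0.
  by case/andP: eta01; nra.
have gw n j : (j < n)%N -> nm (g (i n) (w j)) <= eps n /\ g (i j) (w n) = 0.
  by move=> jn; have [_ _ _ _ [h _ _]] := snext n (sinv n); apply: (h (i j, w j)); apply: sS.
have gw1 n : g (i n) (w n) = 1 by have [_ _ _ _ []] := snext n (sinv n).
have Bw n : Bd (w n) (K n) by have [_ _ _ _ []] := snext n (sinv n).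
exists i, eps; split => //.
  by move=> k; have [_ _ _ [_]] := snext k (sinv k).
move=> b hb.
pose u := fix u n := if n is m.+1 then
  u m + (b m - g (i m) (u m)) *: w m else 0 : W.
pose t n := b n - g (i n) (u n).
have uS n : u n.+1 = u n + t n *: w n by [].
have gu j n : g j (u n.+1) = g j (u n) + t n * g j (w n).
  by rewrite uS (scalar_D (g_lin j)) (scalar_Z (g_lin j)).
(* Both bounds are proved together. The earlier coefficients satisfy [nm (t k) <= 2^-1 ^+ k.+1],
   with partial sums [1 - 2^-1 ^+ n]; since [g (i n)] is at most [eps n] on each earlier [w k], the
   accumulated error is below [eps n] and the next coefficient is at most [2 * eps n]. *)
have ht n : nm (t n) <= 2 * eps n /\ (forall j e, (forall k, (k < n)%N -> nm (g j (w k)) <= e) ->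
    nm (g j (u n)) <= e * (1 - 2^-1 ^+ n)).
  have htn m : (forall j e, (forall k, (k < m)%N -> nm (g j (w k)) <= e) ->
    nm (g j (u m)) <= e * (1 - 2^-1 ^+ m)) -> nm (t m) <= 2 * eps m.
    move=> h; have := h (i m) (eps m) (fun k km => proj1 (gw m k km)).
    have := nmB (b m) (g (i m) (u m)); have := hb m.
    have : 0 <= (2^-1 : R) ^+ m by apply: exprn_ge0.
    by rewrite /t; have := eps0 m; nra.
  elim: n => [|n [IH1 IH2]].
    have h0 : forall j e, (forall k, (k < 0)%N -> nm (g j (w k)) <= e) ->
      nm (g j (u 0%N)) <= e * (1 - 2^-1 ^+ 0).
      by move=> j e _; rewrite (scalar_0 (g_lin j)) nm0 expr0 subrr mulr0.
    by split => //; apply: htn.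
  have hS : forall j e, (forall k, (k < n.+1)%N -> nm (g j (w k)) <= e) ->
      nm (g j (u n.+1)) <= e * (1 - 2^-1 ^+ n.+1).
    move=> j e h; rewrite gu; apply: le_trans (nmD _ _) _.
    have := IH2 j e (fun k kn => h k (ltnW kn)).
    have := h n (ltnSn n); rewrite nmM; have := eps2 n; rewrite exprS.
    have := nm_ge0 (g j (w n)); have := nm_ge0 (t n).
    by set x := nm (t n) in IH1 *; set v := nm (g j (w n)); nra.
  by split => //; apply: htn.
have [y [By hy]] := @complete u eta erefl (fun k => ltac:(
  rewrite uS addrC addKr; apply: (BdW (BdZ (t k) (Bw k))); rewrite -epsK;
  apply: ler_wpM2r; [have := K1 k; lra | exact: (proj1 (ht k))])).
exists y; split => // k; apply: hy; exists k.+1 => n.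
elim: n => // n IH; rewrite ltnS leq_eqVlt gu => /orP[/eqP <-|kn].
  by rewrite gw1 mulr1 /t; ring.
by have [_ ->] := gw n k kn; rewrite mulr0 addr0; apply: IH.
Qed.
End Triangular.

(** * Half-spaces from perturbed eigenvectors *)

Definition perturbed_half_space (R : realType) (X : normedModType R[i])
    (T : X -> X) (eps : R) :=
  exists F : {linear X -> X},
    [/\ bounded_operator F, rank_le1 F, opnorm_lt F eps &
      exists L : set X, half_space L /\ op_invariant (fun x => T x - F x) L].

Section HalfSpaces.
Variables (R : realType) (X : normedModType R[i]).

Lemma rank_one_operator (f : X -> R[i]) (e : X) : scalar f ->
  exists F : {linear X -> X}, forall x, F x = f x *: e.
Proof.
move=> fl; pose F x := f x *: e.
have Fl : linear F by move=> a x y; rewrite /F fl scalerDl scalerA.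
pose G : {linear X -> X} := HB.pack F (GRing.isLinear.Build _ _ _ _ F Fl).
by exists G.
Qed.

Lemma biorthogonal_lin_indep (phi : nat -> X -> R[i]) (v : nat -> X) (L : set X) :
  (forall m, scalar (phi m)) -> (forall m x, L x -> phi m x = 0) ->
  (forall m n, m != n -> phi m (v n) = 0) -> (forall n, phi n (v n) != 0) ->
  forall n, lin_indep_mod L (fun k : 'I_n => v k).
Proof.
move=> pl pL p0 p1 n a /pL h i; have := h i; rewrite (scalar_sum (pl i)).
rewrite (bigD1 i) //= big1 ?addr0; last first.
  by move=> j ji; rewrite p0 ?mulr0 // eq_sym.
by move=> /eqP; rewrite mulf_eq0 (negbTE (p1 i)) orbF => /eqP.
Qed.

Lemma half_space_intro (L : set X) (phi psi : nat -> X -> R[i]) (v w : nat -> X) :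
  linear_subspace L -> eclosed L ->
  (forall m, scalar (phi m)) -> (forall m, scalar (psi m)) ->
  (forall m n, m != n -> phi m (v n) = 0) -> (forall n, phi n (v n) != 0) ->
  (forall m n, m != n -> psi m (w n) = 0) -> (forall n, psi n (w n) != 0) ->
  (forall n, L (v n)) -> (forall m x, L x -> psi m x = 0) -> half_space L.
Proof.
move=> Ls Lc phil psil phi0 phi1 psi0 psi1 Lv psiL; split => //; split.
  exact: eclosed_closed.
split => n; last first.
  by exists (fun k : 'I_n => w k); apply: (biorthogonal_lin_indep psil).
exists (fun k : 'I_n => v k); split => // a a0.
apply: (biorthogonal_lin_indep (L := [set 0]) phil _ phi0 phi1) => //.
by move=> m x ->; apply: scalar_0.
Qed.

Lemma linear_subspace_B (L : set X) x y :
  linear_subspace L -> L x -> L y -> L (x - y).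
Proof. by move=> [_ [LD LZ]] Lx Ly; rewrite -scaleN1r; apply: LD => //; apply: LZ. Qed.
End HalfSpaces.

(** The right-hand sides given to the triangular system: the first one produces the perturbation,
    which acts at even places only, and the second ones a biorthogonal family, scaled by [eps m] to
    be admissible. *)
Lemma alternate_select (R : realType) (b : nat -> R[i]) (eps : nat -> R) :
  (forall k, 0 < eps k) -> (forall k, nm (b k) <= eps k) ->
  (forall k, nm (if odd k then 0 else b k) <= eps k) /\
  (forall m k, nm (if k == m then (eps m)%:C else 0) <= eps k).
Proof.
move=> e0 be; split=> [k|m k]; case: ifP => [h|h] //; rewrite ?nm0 ?(ltW (e0 _)) //.
by rewrite (eqP h) nm_real ger0_norm // ltW.
Qed.

(** * Distance to a subspace and norming functionals *)

Section Distance.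
Variables (R : realType) (X : normedModType R[i]) (M : set X).
Hypothesis MS : linear_subspace M.

Definition dist_to (x : X) : R := inf [set nm (x - m) | m in M].

Let has_inf_dist x : has_inf [set nm (x - m) | m in M].
Proof.
split; first by exists (nm (x - 0)), 0 => //; case: MS.
by exists 0 => _ [m _ <-]; apply: nm_ge0.
Qed.

Lemma dist_to_le x m : M m -> dist_to x <= nm (x - m).
Proof. by move=> Mm; apply: ge_inf; [case: (has_inf_dist x)|exists m]. Qed.

Lemma dist_to_nm x : dist_to x <= nm x.
Proof. by have := @dist_to_le x 0; rewrite subr0; apply; case: MS. Qed.

Lemma le_dist_to x d : (forall m, M m -> d <= nm (x - m)) -> d <= dist_to x.
Proof.
move=> h; apply: lb_le_inf; first by case: (has_inf_dist x).
by move=> _ [m Mm <-]; apply: h.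
Qed.

Lemma dist_to_ge0 x : 0 <= dist_to x.
Proof. by apply: le_dist_to => m _; apply: nm_ge0. Qed.

Lemma dist_to_adherent x e : 0 < e -> exists2 m, M m & nm (x - m) < dist_to x + e.
Proof.
move=> e0; have [_ [m Mm <-] h] := inf_adherent e0 (has_inf_dist x).
by exists m.
Qed.

Lemma dist_to_mem m : M m -> dist_to m = 0.
Proof.
move=> Mm; apply/eqP; rewrite eq_le dist_to_ge0 andbT.
by have := dist_to_le m Mm; rewrite subrr nm0.
Qed.

Lemma dist_toD x y : dist_to (x + y) <= dist_to x + dist_to y.
Proof.
apply/ler_addgt0Pr => e e0; have e2 : 0 < e / 2 by lra.
have [m Mm hm] := dist_to_adherent x e2; have [n Mn hn] := dist_to_adherent y e2.
have [_ [MD _]] := MS; have := dist_to_le (x + y) (MD _ _ Mm Mn).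
have -> : x + y - (m + n) = (x - m) + (y - n) by rewrite opprD addrACA.
by have := nmD (x - m) (y - n); lra.
Qed.

Lemma dist_toZ a x : dist_to (a *: x) = nm a * dist_to x.
Proof.
have [M0 [_ MZ]] := MS.
have [->|a0] := eqVneq a 0; first by rewrite scale0r nm0 mul0r dist_to_mem.
have na : 0 < nm a by rewrite nm_gt0.
apply/eqP; rewrite eq_le; apply/andP; split.
  rewrite -ler_pdivrMl //; apply: le_dist_to => m Mm.
  rewrite ler_pdivrMl // -nmZ scalerBr; apply: dist_to_le; exact: MZ.
apply: le_dist_to => m Mm.
have -> : a *: x - m = a *: (x - a^-1 *: m) by rewrite scalerBr scalerA divff // scale1r.
by rewrite nmZ; apply: ler_wpM2l; [apply: ltW|apply: dist_to_le; apply: MZ].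
Qed.

(** Hahn-Banach for the quotient seminorm [dist_to M]: domination by it forces the functional to
    vanish on [M]. *)
Lemma norming_functional x d : (forall m, M m -> d <= nm (x - m)) ->
  exists f : X -> R[i], [/\ scalar f, forall y, nm (f y) <= nm y,
    forall m, M m -> f m = 0 & d <= nm (f x)].
Proof.
move=> h; have [f [fl fd fx]] := hahn_banach_seminorm dist_toD dist_toZ x.
exists f; split => //.
- by move=> y; apply: le_trans (fd y) (dist_to_nm y).
- move=> m Mm; apply/eqP; rewrite -nm_eq0 eq_le nm_ge0 andbT.
  by have := fd m; rewrite dist_to_mem.
- by apply: le_trans fx; apply: le_dist_to.
Qed.
End Distance.

Section ZeroSubspace.
Variables (R : realType) (X : normedModType R[i]).

Lemma zero_subspace : linear_subspace [set 0 : X].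
Proof.
by split => //; split => [x y -> ->|a x ->]; rewrite ?addr0 ?scaler0.
Qed.

Lemma separating_functional (x : X) : x != 0 ->
  exists f : X -> R[i], [/\ scalar f, exists C, forall y, nm (f y) <= C * nm y & f x = 1].
Proof.
move=> x0; have nx : 0 < nm x by rewrite nm_gt0.
have [|f [fl f1 _ fx]] := @norming_functional _ _ _ zero_subspace x (nm x).
  by move=> m ->; rewrite subr0.
have fx0 : f x != 0 by rewrite -nm_gt0; apply: lt_le_trans fx.
exists (fun y => (f x)^-1 * f y); split.
- by move=> a y z; rewrite fl; ring.
- exists (nm (f x))^-1 => y; rewrite nmM nmV; apply: ler_wpM2l => //.
  by rewrite invr_ge0 nm_ge0.
- by rewrite mulVf.
Qed.
End ZeroSubspace.

Section PerturbedEigenvectors.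
Variables (R : realType) (X : normedModType R[i]) (T : {linear X -> X}).
Variables (M : set X) (I : Type) (U : set_system I).
Hypothesis UU : UltraFilter U.
Variables (v : I -> X) (z c : I -> R[i]) (e : X) (eps delta CT : R).
Hypothesis TC : forall x, nm (T x) <= CT * nm x.
Hypothesis MS : linear_subspace M.
Hypothesis TM : forall x, M x -> M (T x).
Hypothesis v1 : forall i, nm (v i) <= 1.
Hypothesis c0 : ulim U c 0.
Hypothesis Tv : forall i, M (T (v i) - z i *: v i - c i *: e).
Hypothesis delta0 : 0 < delta.
Hypothesis eps0 : 0 < eps.
Hypothesis far : forall A, U A ->
  exists i j, [/\ A i, A j & forall m, M m -> delta <= nm (v i - v j - m)].
Let Bd (f : X -> R[i]^o) (a : R) :=
  [/\ 0 <= a, scalar f, forall x, nm (f x : R[i]) <= a * nm x &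
    forall m, M m -> f m = 0].

(** With [f (v (i k)) = c (i k)] for even [k], the operator [T - F], where [F x = f x *: e], sends
    [v (i k)] to a multiple of itself modulo [M]; it preserves [M] because [f] vanishes there. *)
Lemma perturbed_eigenvectors : perturbed_half_space T eps.
Proof.
have ne0 := nm_ge0 e.
pose eta := Num.min 1 (eps / (2 * (nm e + 1))).
have t0 : 0 < eps / (2 * (nm e + 1)) by apply: divr_gt0 => //; apply: mulr_gt0 => //; lra.
have eta01 : 0 < eta <= 1.
  by rewrite /eta lt_min ltr01 t0 /= ge_min lexx.
have etae : eta * nm e < eps.
  have : eta <= eps / (2 * (nm e + 1)) by rewrite /eta ge_min lexx orbT.
  rewrite ler_pdivlMr; last by lra.
  by case/andP: eta01; nra.
have [||||||u h u0 uB|i [es [es0 cs sol]]] := @triangular_system R (X -> R[i]^o) I U UU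
  (fun i f => f (v i)) Bd c _ _ _ _ _ c0 delta delta0 _ _ eta eta01.
- by [].
- move=> w w' a b [wp wl wa wM] [wp' wl' wa' wM']; split.
  + exact: addr_ge0.
  + move=> t x y; rewrite !fctE wl wl'; ring.
  + by move=> x; rewrite !fctE mulrDl; apply: le_trans (nmD _ _) (lerD _ _).
  + by move=> m Mm; rewrite !fctE wM // wM' // addr0.
- move=> t w a [wp wl wa wM]; split.
  + by apply: mulr_ge0 => //; apply: nm_ge0.
  + by move=> s x y; rewrite !fctE wl /GRing.scale /=; ring.
  + move=> x; rewrite !fctE /GRing.scale /= nmM -mulrA.
    by apply: ler_wpM2l => //; apply: nm_ge0.
  + by move=> m Mm; rewrite !fctE wM // scaler0.
- move=> w a b [wp wl wa wM] ab; split => //; first exact: le_trans wp ab.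
  move=> x; apply: le_trans (wa x) _.
  by apply: ler_wpM2r => //; apply: nm_ge0.
- move=> i w a [wp wl wa wM]; have := wa (v i); have := v1 i.
  have := nm_ge0 (v i); have := nm_ge0 (w (v i) : R[i]); nra.
- move=> A /far [i [j [Ai Aj dist]]]; have [f [fl f1 fM fd]] := norming_functional MS dist.
  exists i, j, f; split => //; last by rewrite -(scalar_B fl).
  by split => // x; rewrite mul1r.
(* Completeness of the dual space: the partial sums converge pointwise, at a rate proportional to
   [nm x], so linearity, the bound and the vanishing on [M] pass to the limit. *)
- have z0 (x : X) : (0 : X -> R[i]^o) x = 0 by [].
  have ul k : scalar (u k).
    elim: k => [|k IH]; first by move=> t x y; rewrite u0 !z0 mulr0 addr0.
    have [_ dl _ _] := uB k; move=> t x y; have := dl t x y; rewrite !fctE IH => /eqP.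
    by rewrite subr_eq => /eqP ->; ring.
  have uM k m : M m -> u k m = 0.
    move=> Mm; elim: k => [|k IH]; first by rewrite u0 z0.
    by have [_ _ _ /(_ m Mm)] := uB k; rewrite !fctE IH subr0.
  have h0 : 0 <= h by have [+ _ _ _] := uB 0%N; rewrite expr1; lra.
  have q01 : 0 <= (2^-1 : R) < 1 by lra.
  have ulimx x : exists l : R[i], forall n, nm (l - u n x) <= h * nm x * 2^-1 ^+ n.
    have [|l hl] := @scalar_limit R (fun n => u n x) (h / 2 * nm x) 2^-1 q01.
      move=> n; have [_ _ /(_ x) + _] := uB n; rewrite !fctE exprS.
      by move=> /le_trans; apply; lra.
    exists l => n; apply: le_trans (hl n) _.
    by have -> : h / 2 * nm x / (1 - 2^-1) = h * nm x by field; lra.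
  have [y hy] := choice ulimx.
  have small (p : R[i]) (b : R) : (forall n, nm p <= b * 2^-1 ^+ n) -> p = 0.
    move=> hp; apply: nm_eps0 => d d0; have [N HN] := exprn_small b q01 d0.
    by apply: le_trans (hp N) (ltW (HN N (leqnn N))).
  exists y; split; first split => //.
  + move=> t a b; apply/eqP; rewrite -subr_eq0; apply/eqP.
    apply: (small _ (h * nm (t *: a + b) + nm t * (h * nm a) + h * nm b)) => n.
    have -> : y (t *: a + b) - (t * y a + y b) =
      (y (t *: a + b) - u n (t *: a + b)) - (t * (y a - u n a) + (y b - u n b)).
      by rewrite ul; ring.
    apply: le_trans (nmB _ _) _; rewrite !mulrDl -addrA; apply: lerD; first exact: hy.
    apply: le_trans (nmD _ _) _; apply: lerD; last exact: hy.
    by rewrite nmM -mulrA; apply: ler_wpM2l; [apply: nm_ge0|apply: hy].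
  + by move=> x; have := hy x 0%N; rewrite u0 z0 expr0 mulr1 subr0.
  + move=> m Mm; apply: (small _ (h * nm m)) => n.
    by have := hy m n; rewrite uM // subr0.
  + move=> i a [N HN]; apply/eqP; rewrite -subr_eq0; apply/eqP.
    apply: nm_eps0 => d d0; have [K HK] := exprn_small (h * nm (v i)) q01 d0.
    have := hy (v i) (maxn N K); rewrite (HN _ (leq_maxl _ _)) => /le_trans; apply.
    by apply/ltW/HK; apply: leq_maxr.
pose b k := c (i k).
have [b1 b2] := alternate_select (b := b) es0 cs.
have [f [[_ fl fa fM] fb]] := sol _ b1.
have [phi hphi] := choice (fun m => sol _ (b2 m)).
have phil m : scalar (phi m) by have [[]] := hphi m.
have phi0 m n : m != n -> phi m (v (i n)) = 0.
  by move=> mn; have [_ ->] := hphi m; rewrite eq_sym (negbTE mn).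
have phi1 n : phi n (v (i n)) != 0.
  have [_ ->] := hphi n; rewrite eqxx -nm_gt0 nm_real ger0_norm ?(ltW (es0 n)) //.
have [F FE] := rank_one_operator e fl.
have FC x : nm (F x) <= eta * nm e * nm x.
  rewrite FE nmZ; have := fa x; have := nm_ge0 x; nra.
exists F; split.
- rewrite /bounded_operator; exact: bdd_continuous FC.
- by exists e => x; exists (f x); rewrite FE.
- by exists (eta * nm e) => // x; rewrite !nmE -rmorphM lecR.
(* The half-space is the closed span of [M] and the even [v (i k)], presented as the common kernel
   of its annihilator [D]: closedness is then immediate, and invariance is checked on the
   adjoint. *)
pose D (y : X -> R[i]) := (exists a, Bd y a) /\ forall k, ~~ odd k -> y (v (i k)) = 0.
exists [set x | forall y, D y -> y x = 0]; split.
  apply: (@half_space_intro _ _ _ (fun m => phi m.*2) (fun m => phi m.*2.+1)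
    (fun n => v (i n.*2)) (fun n => v (i n.*2.+1))) => //.
  + split; first by move=> y [[a [_ yl _ _]] _]; apply: scalar_0.
    split.
      move=> x y hx hy w Dw; have [[a [_ wl _ _]] _] := Dw.
      by rewrite (scalar_D wl) hx // hy // addr0.
    move=> t x hx w Dw; have [[a [_ wl _ _]] _] := Dw.
    by rewrite (scalar_Z wl) hx // mulr0.
  + move=> x hx w Dw; have [[a [a0 wl wa _]] _] := Dw.
    apply: nm_eps0 => d d0.
    have [|y hy xy] := hx (d / (a + 1)); first by apply: divr_gt0 => //; lra.
    have -> : w x = w (x - y) by rewrite (scalar_B wl) hy // subr0.
    apply: le_trans (wa _) _.
    move: xy; rewrite ltr_pdivlMr; last by lra.
    by have := nm_ge0 (x - y); nra.
  + by move=> m n mn; rewrite phi0 // (inj_eq double_inj).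
  + by move=> m n mn; rewrite phi0 // eqSS (inj_eq double_inj).
  + by move=> n y [_ ->] //; rewrite odd_double.
  + move=> m x; apply; split; first by exists eta; have [] := hphi m.*2.+1.
    move=> k ok; apply: phi0; apply: contraNneq ok => <-.
    by rewrite /= odd_double.
move=> x hx y [[a [a0 yl ya yM]] yv].
have yT w : D w -> D (fun x => w (T x - F x)).
  move=> [[a' [a'0 wl wa wM]] wv]; split.
    have CTm : 0 <= Num.max CT 0 + eta * nm e.
      by apply: addr_ge0; [rewrite le_max lexx orbT|case/andP: eta01 => ? _; nra].
    exists (a' * (Num.max CT 0 + eta * nm e)); split.
    - exact: mulr_ge0.
    - move=> t x1 x2; rewrite !linearP /= -wl; congr w.
      by rewrite scalerDr addrACA.
    - move=> x1; apply: le_trans (wa _) _; rewrite -mulrA; apply: ler_wpM2l => //.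
      apply: le_trans (nmB _ _) _; rewrite mulrDl; apply: lerD (FC _).
      apply: le_trans (TC _) _; apply: ler_wpM2r; first exact: nm_ge0.
      by rewrite le_max lexx.
    - move=> m Mm; rewrite FE fM // scale0r subr0; apply: wM; exact: TM.
  move=> k ok; rewrite FE fb (negbTE ok).
  have := wM _ (Tv (i k)).
  rewrite !(scalar_B wl) (scalar_Z wl _ (v (i k))) wv // mulr0 subr0 => h.
  exact: h.
by apply: (hx (fun x => y (T x - F x))); apply: yT; split => //; exists a.
Qed.
End PerturbedEigenvectors.

(** * Half-spaces from perturbed eigenfunctionals *)

Section PerturbedEigenfunctionals.
Variables (R : realType) (X : completeNormedModType R[i]) (T : {linear X -> X}).
Variables (Y : set X) (I : Type) (U : set_system I).
Hypothesis UU : UltraFilter U.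
Variables (g : I -> X -> R[i]) (f : X -> R[i]) (z c : I -> R[i]) (eps delta Cf : R).
Hypothesis YS : linear_subspace Y.
Hypothesis YC : eclosed Y.
Hypothesis TY : forall x, Y x -> Y (T x).
Hypothesis gl : forall i, scalar (g i).
Hypothesis g1 : forall i y, Y y -> nm (g i y) <= nm y.
Hypothesis fl : scalar f.
Hypothesis fC : forall x, nm (f x) <= Cf * nm x.
Hypothesis c0 : ulim U c 0.
Hypothesis gT : forall i y, Y y -> g i (T y) = z i * g i y + c i * f y.
Hypothesis delta0 : 0 < delta.
Hypothesis eps0 : 0 < eps.
Hypothesis far : forall A, U A ->
  exists i j w, [/\ A i, A j, Y w, nm w <= 1 & delta <= nm (g i w - g j w)].

(** The dual situation: now a small vector [e] in [Y] is sought, with [g (i k) e = c (i k)] for even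
    [k], so that on [Y] these [g (i k)] become eigenfunctionals of [T - F]. The roles are exchanged
    as well: odd indices witness the infinite dimension of the common kernel, even ones its infinite
    codimension. *)
Lemma perturbed_eigenfunctionals : perturbed_half_space T eps.
Proof.
have [Y0 [YD YZ]] := YS.
pose Bd (w : X) (a : R) := Y w /\ nm w <= a.
pose C := Num.max Cf 0.
have C0 : 0 <= C by rewrite le_max lexx orbT.
have fC' x : nm (f x) <= C * nm x.
  by apply: le_trans (fC x) _; apply: ler_wpM2r; [apply: nm_ge0|rewrite le_max lexx].
pose eta := Num.min 1 (eps / (2 * (C + 1))).
have t0 : 0 < eps / (2 * (C + 1)) by apply: divr_gt0 => //; apply: mulr_gt0 => //; lra.
have eta01 : 0 < eta <= 1 by rewrite /eta lt_min ltr01 t0 /= ge_min lexx.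
have etaC : C * eta < eps.
  have : eta <= eps / (2 * (C + 1)) by rewrite /eta ge_min lexx orbT.
  rewrite ler_pdivlMr; last by lra.
  by case/andP: eta01; nra.
have [|||||u h u0 uB|i [es [es0 cs sol]]] := @triangular_system R X I U UU
  g Bd c gl _ _ _ _ c0 delta delta0 _ _ eta eta01.
- move=> w w' a b [Yw wa] [Yw' wb]; split; first exact: YD.
  by apply: le_trans (nmD _ _) (lerD _ _).
- move=> t w a [Yw wa]; split; first exact: YZ.
  by rewrite nmZ; apply: ler_wpM2l => //; apply: nm_ge0.
- by move=> w a b [Yw wa] ab; split => //; apply: le_trans ab.
- by move=> j w a [Yw wa]; apply: le_trans wa; apply: g1.
- by move=> A /far [j [k [w [Aj Ak Yw w1 d]]]]; exists j, k, w.
- have q01 : 0 <= (2^-1 : R) < 1 by lra.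
  have [|y hy] := @series_limit _ _ u (h / 2) _ q01.
    by move=> n; have [_] := uB n; rewrite exprS mulrA.
  have hh : h / 2 / (1 - 2^-1) = h by field; lra.
  rewrite hh in hy.
  have Yu n : Y (u n).
    elim: n => [|n IH]; first by rewrite u0.
    by have [Yd _] := uB n; rewrite -(subrK (u n) (u n.+1)); apply: YD.
  have small d : 0 < d -> exists N, forall n, (N <= n)%N -> nm (y - u n) < d.
    move=> d0; have [N HN] := exprn_small h q01 d0.
    by exists N => n Nn; apply: le_lt_trans (hy n) (HN n Nn).
  have Yy : Y y.
    apply: YC => d d0; have [N HN] := small d d0.
    by exists (u N) => //; apply: HN.
  exists y; split.
    by split => //; have := hy 0%N; rewrite u0 subr0 expr0 mulr1.
  move=> j a [N HN]; apply/eqP; rewrite -subr_eq0; apply/eqP; apply: nm_eps0 => d d0.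
  have [K HK] := small d d0.
  rewrite -(HN _ (leq_maxl N K)) -(scalar_B (gl j)).
  apply: le_trans (g1 _ _) (ltW (HK _ (leq_maxr N K))).
  exact: linear_subspace_B.
pose b k := c (i k).
have [b1 b2] := alternate_select (b := b) es0 cs.
have [e [[Ye ee] eb]] := sol _ b1.
have [y hy] := choice (fun m => sol _ (b2 m)).
have Yy m : Y (y m) by have [[]] := hy m.
have gy0 m n : m != n -> g (i m) (y n) = 0.
  by move=> mn; have [_ ->] := hy n; rewrite (negbTE mn).
have gy1 n : g (i n) (y n) != 0.
  by have [_ ->] := hy n; rewrite eqxx -nm_gt0 nm_real ger0_norm ?(ltW (es0 n)).
have [F FE] := rank_one_operator e fl.
have FC x : nm (F x) <= C * eta * nm x.
  rewrite FE nmZ; have := fC' x; have := nm_ge0 x; have := nm_ge0 (f x).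
  have := nm_ge0 e; case/andP: eta01 => ? ? h1 h2 h3 h4.
  apply: le_trans (_ : C * nm x * nm e <= _); first exact: ler_wpM2r.
  rewrite -mulrA [nm x * _]mulrC mulrA; apply: ler_wpM2r => //.
  exact: ler_wpM2l.
exists F; split.
- rewrite /bounded_operator; exact: bdd_continuous FC.
- by exists e => x; exists (f x); rewrite FE.
- by exists (C * eta) => // x; rewrite !nmE -rmorphM lecR.
exists [set x | Y x /\ forall k, ~~ odd k -> g (i k) x = 0]; split.
  apply: (@half_space_intro _ _ _ (fun m => g (i m.*2.+1)) (fun m => g (i m.*2))
    (fun n => y n.*2.+1) (fun n => y n.*2)) => //.
  + split; first by split => // k _; apply: scalar_0.
    split.
      move=> x x' [Yx gx] [Yx' gx']; split; first exact: YD.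
      by move=> k ok; rewrite (scalar_D (gl _)) gx // gx' // addr0.
    move=> t x [Yx gx]; split; first exact: YZ.
    by move=> k ok; rewrite (scalar_Z (gl _)) gx // mulr0.
  + move=> x hx; have Yx : Y x.
      by apply: YC => d d0; have [x' [Yx' _] xx'] := hx d d0; exists x'.
    split => // k ok; apply: nm_eps0 => d d0; have [x' [Yx' gx'] xx'] := hx d d0.
    have -> : g (i k) x = g (i k) (x - x') by rewrite (scalar_B (gl _)) gx' // subr0.
    by apply: le_trans (g1 _ _) (ltW xx'); apply: linear_subspace_B.
  + by move=> m n mn; rewrite gy0 // eqSS (inj_eq double_inj).
  + by move=> m n mn; rewrite gy0 // (inj_eq double_inj).
  + move=> n; split => // k ok; apply: gy0; apply: contraNneq ok => ->.
    by rewrite /= odd_double.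
  + by move=> m x [_]; apply; rewrite odd_double.
move=> x [Yx gx]; split; first by apply: linear_subspace_B => //; [apply: TY|rewrite FE; apply: YZ].
move=> k ok; rewrite FE (scalar_B (gl _)) (scalar_Z (gl _)) gT // gx // eb (negbTE ok).
by rewrite /b; ring.
Qed.
End PerturbedEigenfunctionals.

(** * Infinite dimensional kernels *)

Section Dimension.
Variables (R : realType) (X : normedModType R[i]).

Lemma infinite_dimensional_kernel (V : set X) (g : X -> R[i]) :
  linear_subspace V -> scalar g -> infinite_dimensional V ->
  infinite_dimensional [set x | V x /\ g x = 0].
Proof.
move=> [V0 [VD VZ]] gl Vinf n; have [v [Vv vi]] := Vinf n.+1.
(* A pivot with nonzero value if there is one; if [g] kills the whole family, any index serves, and
   the later quotients by 0 are harmless. *)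
have [i0 hi0] : exists i0, forall i, g (v i0) = 0 -> g (v i) = 0.
  have [[i0 gi0]|h] := pselect (exists i0, g (v i0) <> 0).
    by exists i0.
  exists ord0 => i _; apply: contrapT => gi; apply: h; by exists i.
pose r i := g (v (lift i0 i)) / g (v i0).
exists (fun i => v (lift i0 i) - r i *: v i0); split.
  move=> i; split; first by rewrite -scaleNr; apply: VD => //; apply: VZ.
  rewrite (scalar_B gl) (scalar_Z gl) /r.
  have [g0|g0] := eqVneq (g (v i0)) 0; first by rewrite hi0 // g0 mulr0 subr0.
  by rewrite divfK // subrr.
move=> a sa i.
pose b j := if unlift i0 j is Some k then a k else - \sum_k a k * r k.
have bi : b (lift i0 i) = a i by rewrite /b liftK.
rewrite -bi; apply: vi; rewrite (bigD1_ord i0) //=.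
rewrite /b unlift_none scaleNr scaler_suml -sumrN -big_split /= -[RHS]sa.
by apply: eq_bigr => k _; rewrite liftK scalerBr scalerA addrC.
Qed.

Lemma infinite_dimensional_sub (V W : set X) : V `<=` W ->
  infinite_dimensional V -> infinite_dimensional W.
Proof. by move=> VW h n; have [v [Vv vi]] := h n; exists v; split => // i; apply: VW. Qed.

Lemma infinite_dimensional_neq0 (V : set X) : infinite_dimensional V ->
  exists2 x, V x & x != 0.
Proof.
move=> h; have [v [Vv vi]] := h 1%N; exists (v ord0) => //.
apply/negP => /eqP v0; have := vi (fun=> 1).
by rewrite big_ord1 v0 scaler0 => /(_ erefl ord0) /eqP; rewrite oner_eq0.
Qed.

(** Each new unit vector [y] is followed by passing to the kernel of a norming functional [f] of
    [y]: any later vector [w] has [f w = 0], so [nm (y - w)] is at least [nm (f y)], which is 1. *)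
Lemma separated_sequence (V : set X) : linear_subspace V -> infinite_dimensional V ->
  exists v : nat -> X, [/\ forall n, V (v n), forall n, nm (v n) = 1 &
    forall n m, (n < m)%N -> 1 <= nm (v n - v m)].
Proof.
move=> VS Vinf.
pose good (W : set X) := [/\ linear_subspace W, infinite_dimensional W & W `<=` V].
pose next (s s' : set X * X) := good s.1 -> [/\ good s'.1, s'.1 `<=` s.1,
  s.1 s'.2 & nm s'.2 = 1 /\ forall y, s'.1 y -> 1 <= nm (s'.2 - y)].
have step s : {s' | next s s'}.
  apply: cid; have [[WS Winf WV]|ng] := pselect (good s.1); last by exists s.
  have [x Wx x0] := infinite_dimensional_neq0 Winf.
  have nx : 0 < nm x by rewrite nm_gt0.
  pose y := ((nm x)^-1)%:C *: x.
  have ny : nm y = 1.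
    by rewrite nmZ nm_real ger0_norm ?invr_ge0 ?nm_ge0 // mulVf // gt_eqF.
  have Wy : s.1 y by case: WS => _ [_ WZ]; apply: WZ.
  have [|f [fl f1 _ fy]] := @norming_functional _ _ _ (zero_subspace X) y 1.
    by move=> m ->; rewrite subr0 ny.
  exists ([set w | s.1 w /\ f w = 0], y) => _; split => //=.
  - split; last by move=> w [Ww _]; apply: WV.
      case: WS => W0 [WD WZ]; split; first by split => //; apply: scalar_0.
      split => [a b [Wa fa] [Wb fb]|t a [Wa fa]]; split.
      + exact: WD.
      + by rewrite (scalar_D fl) fa fb addr0.
      + exact: WZ.
      + by rewrite (scalar_Z fl) fa mulr0.
    exact: infinite_dimensional_kernel.
  - by move=> w [].
  split => // w [Ww fw]; apply: le_trans (f1 _).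
  by rewrite (scalar_B fl) fw subr0.
have [s [s0 hs]] := dependent_choice step (V, 0).
have gs n : good (s n).1.
  by elim: n => [|n IH]; [rewrite s0; split|have [] := hs n IH].
have dec n m : (n <= m)%N -> (s m).1 `<=` (s n).1.
  elim: m => [|m IH]; first by rewrite leqn0 => /eqP ->.
  rewrite leq_eqVlt => /orP[/eqP <- //|/IH nm_].
  by have [_ h _ _] := hs m (gs m); apply: subset_trans h nm_.
exists (fun n => (s n.+1).2); split => n.
- by have [_ _ V' _] := hs n (gs n); have [_ _] := gs n; apply.
- by have [_ _ _ []] := hs n (gs n).
move=> m nm_; have [_ _ _ [_]] := hs n (gs n); apply.
by have [_ _ V' _] := hs m (gs m); apply: dec V'.
Qed.

(** Induction on the rank: if [f (A u) = 1], restricting to the kernel of [f \o A] keeps the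
    dimension infinite, and an independent family in the new image can be enlarged by [A u]. *)
Lemma infinite_dimensional_kernel_map (A : {linear X -> X}) d (V : set X) :
  linear_subspace V -> infinite_dimensional V ->
  ~ (exists v : 'I_d.+1 -> X, (forall i, exists2 u, V u & v i = A u) /\ lin_indep v) ->
  infinite_dimensional [set x | V x /\ A x = 0].
Proof.
elim: d V => [|d IH] V VS Vinf noV.
all: have [h|h] := pselect (forall u, V u -> A u = 0);
  first by apply: infinite_dimensional_sub Vinf => x Vx; split => //; apply: h.
all: have [u Vu Au] : exists2 u, V u & A u != 0
  by apply: contrapT => hh; apply: h => u Vu; apply/eqP/negP => /negP Au; apply: hh; exists u.
  exfalso; apply: noV; exists (fun=> A u); split; first by exists u.
  move=> a; rewrite big_ord1 => /eqP; rewrite scaler_eq0 (negbTE Au) orbF => /eqP a0 i.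
  by rewrite (ord1 i).
have [f [fl _ fu]] := separating_functional Au.
have fAl : scalar (f \o A) by move=> t x y; rewrite /= linearP fl.
have := infinite_dimensional_kernel VS fAl Vinf; set V' := [set x | _] => V'inf.
apply: (@infinite_dimensional_sub [set x | V' x /\ A x = 0]).
  by move=> x [[]].
apply: IH => //.
  case: VS => V0 [VD VZ]; split; first by split => //; apply: (scalar_0 fAl).
  split => [x y [Vx fx] [Vy fy]|t x [Vx fx]]; split.
  - exact: VD.
  - by rewrite (scalar_D fAl) fx fy addr0.
  - exact: VZ.
  - by rewrite (scalar_Z fAl) fx mulr0.
move=> [v [Vv vi]]; apply: noV.
exists (fun i => if unlift ord0 i is Some j then v j else A u); split.
  move=> i; case: unliftP => [j _|_]; last by exists u.
  by have [w [Vw _] ->] := Vv j; exists w.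
move=> a; rewrite big_ord_recl /= unlift_none.
under eq_bigr => i _ do rewrite liftK.
move=> s0.
have a0 : a ord0 = 0.
  have := congr1 f s0; rewrite (scalar_D fl) (scalar_Z fl) fu mulr1 (scalar_0 fl).
  rewrite (scalar_sum fl) big1 ?addr0 // => i _.
  by have [w [_ fw] ->] := Vv i; rewrite [f _]fw mulr0.
move=> i; case: (unliftP ord0 i) => [j ->|-> //].
move: s0; rewrite a0 scale0r add0r => s0.
exact: (vi (fun j => a (lift ord0 j)) s0 j).
Qed.
End Dimension.

Section InfiniteKernel.
Variables (R : realType) (X : normedModType R[i]).

Lemma nat_ultrafilter : exists U : set_system nat, UltraFilter U /\
  forall n, U [set m | (n <= m)%N].
Proof.
have [U [UU sU]] := @ultraFilterLemma nat \oo _.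
by exists U; split => // n; apply: sU; exists n.
Qed.

Definition opshift (T : X -> X) (a : R[i]) (x : X) := T x - a *: x.

(** Constant eigenvalue [a], [c = 0] and [e = 0]: the perturbation is the zero operator, and what is
    extracted is a half-space inside the eigenspace. *)
Lemma perturbed_infinite_kernel (T : {linear X -> X}) (CT eps : R) (a : R[i]) :
  (forall x, nm (T x) <= CT * nm x) -> 0 < eps ->
  infinite_dimensional [set x | opshift T a x = 0] -> perturbed_half_space T eps.
Proof.
move=> TC eps0 inf.
have VS : linear_subspace [set x | opshift T a x = 0].
  split; first by rewrite /= /opshift linear0 scaler0 subr0.
  split => [x y|t x] /eqP; rewrite /opshift subr_eq0 => /eqP hx.
    by move=> /eqP; rewrite subr_eq0 => /eqP hy; rewrite /= /opshift linearD hx hy scalerDr subrr.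
  by rewrite /= /opshift linearZ /= hx !scalerA mulrC subrr.
have [v [Vv v1 vsep]] := separated_sequence VS inf.
have [U [UU Un]] := nat_ultrafilter.
have UP : ProperFilter U by exact: ultra_proper.
apply: (@perturbed_eigenvectors R X T [set 0] nat U UU v (fun=> a) (fun=> 0) 0 eps 1 CT TC (zero_subspace X)) => //.
- by move=> x ->; rewrite linear0.
- by move=> n; rewrite v1.
- by move=> e e0; apply: filterS filterT => n _ /=; rewrite subrr nm0.
- by move=> n; rewrite scale0r subr0; apply: Vv.
- move=> A UA; have [i Ai] := filter_ex UA.
  have [j [Aj /= ij]] := filter_ex (filterI UA (Un i.+1)).
  by exists i, j; split => // m ->; rewrite subr0; apply: vsep.
Qed.
End InfiniteKernel.

(** * Polynomials in T and Jordan chains *)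

Section Shift.
Variables (R : realType) (X : normedModType R[i]) (T : {linear X -> X}).

Lemma opshift_linear a : linear (opshift T a).
Proof.
move=> t x y; rewrite /opshift linearP scalerDr opprD addrACA; congr (_ + _).
by rewrite scalerBr !scalerA mulrC.
Qed.

HB.instance Definition _ (a : R[i]) :=
  GRing.isLinear.Build R[i] X X *:%R (opshift T a) (@opshift_linear a).

Lemma opshift_bdd CT a : (forall x, nm (T x) <= CT * nm x) ->
  forall x, nm (opshift T a x) <= (CT + nm a) * nm x.
Proof.
move=> TC x; apply: le_trans (nmB _ _) _; rewrite nmZ mulrDl.
by apply: lerD.
Qed.

Lemma opshift_opshift a b x : opshift T a x = opshift T b x + (b - a) *: x.
Proof. by rewrite /opshift scalerBl addrA subrK. Qed.

Definition polyop (s : seq R[i]) (x : X) := foldr (fun a y => opshift T a y) x s.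

Lemma polyop_linear s : linear (polyop s).
Proof. by elim: s => [|a s IH] t x y //=; rewrite IH linearP. Qed.

HB.instance Definition _ (s : seq R[i]) :=
  GRing.isLinear.Build R[i] X X *:%R (polyop s) (@polyop_linear s).

(** As the factors are applied one by one, the range passes from infinite to finite dimension at
    some factor; that factor has an infinite dimensional kernel on the preceding range. *)
Lemma algebraic_infinite_kernel s : infinite_dimensional_space X ->
  (forall x, polyop s x = 0) -> exists a, infinite_dimensional [set x | opshift T a x = 0].
Proof.
move=> Xinf s0.
have : ~ infinite_dimensional (range (polyop s)).
  move=> /infinite_dimensional_neq0 [_ [y _ <-]]; by rewrite s0 eqxx.
elim: s {s0} => [|a s IH] ninf.
  case: ninf => n; have [v vi] := Xinf n; exists v; split => // i; by exists (v i).
have [inf|/IH //] := pselect (infinite_dimensional (range (polyop s))).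
exists a.
have [n hn] : exists n, ~ exists v : 'I_n -> X,
    (forall i, range (polyop (a :: s)) (v i)) /\ lin_indep v.
  by apply: contrapT => h; apply: ninf => n; apply: contrapT => h'; apply: h; exists n.
case: n hn => [[]|d hd].
  by exists (fun=> 0); split; [case|move=> ? _ []].
have VS : linear_subspace (range (polyop s)).
  split; first by exists 0 => //; rewrite linear0.
  split => [_ _ [x _ <-] [y _ <-]|t _ [x _ <-]].
    by exists (x + y) => //; rewrite linearD.
  by exists (t *: x) => //; rewrite linearZ.
apply: (infinite_dimensional_sub _ (@infinite_dimensional_kernel_map R X (opshift T a) d _ VS inf _)).
  by move=> x [].
move=> [v [Vv vi]]; apply: hd; exists v; split => // i.
by have [u [y _ <-] ->] := Vv i; exists y.
Qed.

Lemma iter_opshift_linear a k : linear (iter k (opshift T a)).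
Proof. by elim: k => [|k IH] t x y //=; rewrite IH linearP. Qed.

HB.instance Definition _ (a : R[i]) (k : nat) :=
  GRing.isLinear.Build R[i] X X *:%R (iter k (opshift T a)) (@iter_opshift_linear a k).

Lemma iter_opshift_bdd CT a k : (forall x, nm (T x) <= CT * nm x) ->
  exists2 C : R, 0 < C & forall x, nm (iter k (opshift T a) x) <= C * nm x.
Proof.
move=> TC; elim: k => [|k [C C0 IH]]; first by exists 1 => // x; rewrite mul1r.
exists ((`|CT| + nm a + 1) * C).
  by apply: mulr_gt0 => //; have := nm_ge0 a; have := normr_ge0 CT; lra.
move=> x /=; apply: le_trans (opshift_bdd a TC _) _; rewrite -mulrA.
apply: le_trans (_ : (`|CT| + nm a + 1) * nm (iter k (opshift T a) x) <= _).
  by apply: ler_wpM2r; [exact: nm_ge0|have := ler_norm CT; lra].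
by apply: ler_wpM2l => //; have := nm_ge0 a; have := normr_ge0 CT; lra.
Qed.

(* [ker S] meets the ranges of the powers of [S] in a decreasing sequence of
   subspaces, which stabilises when [ker S] is finite dimensional. *)
Lemma jordan_chain a :
  ~ infinite_dimensional [set x | opshift T a x = 0] ->
  (forall k, exists2 x, iter k.+1 (opshift T a) x = 0 & iter k (opshift T a) x <> 0) ->
  exists x : nat -> X, [/\ x 0%N != 0, opshift T a (x 0%N) = 0 &
    forall n, opshift T a (x n.+1) = x n].
Proof.
move=> Sfin Sgrow.
pose K j : set X := [set x | (opshift T a) x = 0 /\ exists y, x = iter j (opshift T a) y].
have Kdec i j : (i <= j)%N -> K j `<=` K i.
  move=> ij x [Sx [y xy]]; split => //; exists (iter (j - i) (opshift T a) y).
  by rewrite -iterD subnKC.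
have KS j : linear_subspace (K j).
  split; first by split; [exact: linear0|exists 0; rewrite linear0].
  split => [x y [Sx [x' hx]] [Sy [y' hy]]|t x [Sx [x' hx]]].
    split; first by rewrite [LHS]linearD /= Sx Sy addr0.
    by exists (x' + y'); rewrite linearD hx hy.
  by split; [rewrite [LHS]linearZ /= Sx scaler0|exists (t *: x'); rewrite linearZ /= hx].
have [J KJ] : exists J, forall j, (J <= j)%N -> K J `<=` K j.
  apply: contrapT => h; apply: Sfin.
  have step (p : nat * X) : {q : nat * X | (p.1 < q.1)%N /\ K p.1 q.2 /\ ~ K q.1 q.2}.
    apply: cid; apply: contrapT => h'; apply: h; exists p.1 => j pj x Kx.
    apply: contrapT => Kjx; apply: h'; exists (j, x); split => //=.
    by rewrite ltn_neqAle pj andbT; apply: contra_notN Kjx => /eqP <-.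
  have [q [q0 hq]] := dependent_choice step (0%N, 0).
  have qmono n m : (n <= m)%N -> ((q n).1 <= (q m).1)%N.
    elim: m => [|m IH]; first by rewrite leqn0 => /eqP ->.
    rewrite leq_eqVlt => /orP[/eqP -> //|/IH h1].
    by apply: leq_trans h1 (ltnW _); case: (hq m).
  move=> n; exists (fun i : 'I_n => (q i.+1).2); split.
    by move=> i; have [_ [[]]] := hq i.
  move=> b sb.
  (* From the lowest index upwards: a nonzero first coefficient would express [(q i.+1).2] through
     later vectors, which all lie in [K (q i.+1).1], whereas it was chosen outside. *)
  suff H m : forall i : 'I_n, (i < m)%N -> b i = 0 by move=> i; apply: (H i.+1).
  elim: m => // m IH i; rewrite ltnS leq_eqVlt => /orP[/eqP im|]; last exact: IH.
  apply/eqP/negP => /negP bi; have [_ [_ nK]] := hq i; apply: nK.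
  have [K0 [KD KZ]] := KS (q i.+1).1.
  have -> : (q i.+1).2 = (b i)^-1 *: - (\sum_(l < n | l != i) b l *: (q l.+1).2).
    move: sb; rewrite (bigD1 i) //= => /eqP; rewrite addr_eq0 => /eqP <-.
    by rewrite scalerA mulVf // scale1r.
  apply: (KZ); rewrite -scaleN1r; apply: (KZ).
  elim/big_ind: _ => // l li.
  have [lm|ml] := ltnP l i; first by rewrite IH ?scale0r // -im.
  apply: KZ; have [_ [Kl _]] := hq l; apply: Kdec Kl; apply: qmono.
  by rewrite ltn_neqAle ml andbT eq_sym; apply: contraNneq li => h1; apply/eqP/val_inj.
pose good x := forall j, exists y, x = iter j (opshift T a) y.
have KJgood x : K J x -> good x.
  move=> Kx j; have [Jj|jJ] := leqP J j; first by have [_] := KJ j Jj x Kx.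
  by have [_] := Kdec j J (ltnW jJ) x Kx.
(* A preimage [S^J y] of [x] may fail to be in the range of all powers. It differs from a preimage
   in the range of a high power by a vector of [K J], and vectors of [K J] are in all ranges, so it
   is good after all. *)
have step (x : X) : {x' | good x -> (opshift T a) x' = x /\ good x'}.
  apply: cid; have [gx|] := pselect (good x); last by exists 0.
  have [y xy] := gx J.+1; exists (iter J (opshift T a) y) => _; split; first by rewrite xy.
  move=> j; have [y' xy'] := gx (maxn J j).+1.
  have Kd : K J (iter J (opshift T a) y - iter (maxn J j) (opshift T a) y').
    split; first by rewrite [LHS]linearB /= -!iterS -xy -xy' subrr.
    exists (y - iter (maxn J j - J) (opshift T a) y'); rewrite linearB; congr (_ - _).
    by rewrite /= -iterD subnKC // leq_maxl.
  have [w hw] := KJgood _ Kd j.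
  exists (w + iter (maxn J j - j) (opshift T a) y'); rewrite linearD /= -hw -iterD.
  by rewrite subnKC ?leq_maxr // subrK.
have [y hy0 hy1] := Sgrow J.
have KJy : K J (iter J (opshift T a) y) by split => //; exists y.
have [x [x0 hx]] := dependent_choice step (iter J (opshift T a) y).
have gx n : good (x n).
  elim: n => [|n IH]; first by rewrite x0; apply: KJgood.
  by have [] := hx n IH.
exists x; split; first by rewrite x0; apply/eqP.
  by rewrite x0.
by move=> n; have [] := hx n (gx n).
Qed.
End Shift.

(** * Resolvents *)

Section Resolvent.
Variables (R : realType) (X : normedModType R[i]) (T : {linear X -> X}).

Definition is_resolvent (z : R[i]) (r : X -> X) :=
  [/\ forall x, r (opshift T z x) = x, forall x, opshift T z (r x) = x &
    exists C, forall x, nm (r x) <= C * nm x].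

Definition regular z := exists r, is_resolvent z r.

(** The zero map as default keeps [resolvent z] linear for every [z], so that the linear structure
    can be declared without a condition. *)
Definition resolvent z : X -> X := xget (fun=> 0) [set r | is_resolvent z r].

Lemma resolventP z : regular z -> is_resolvent z (resolvent z).
Proof.
by move=> [r hr]; rewrite /resolvent; case: xgetP => [r' -> //|/(_ r hr)].
Qed.

Lemma resolventK z x : regular z -> resolvent z (opshift T z x) = x.
Proof. by move=> /resolventP []. Qed.

Lemma opshiftK z x : regular z -> opshift T z (resolvent z x) = x.
Proof. by move=> /resolventP []. Qed.

Lemma resolvent_linear z : linear (resolvent z).
Proof.
have [rz|nrz] := pselect (regular z).
  by move=> t x y; rewrite -[RHS](resolventK _ rz) linearP /= !opshiftK.
move=> t x y; rewrite /resolvent; case: xgetP => [r _ hr|_].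
  by case: nrz; exists r.
by rewrite scaler0 addr0.
Qed.

HB.instance Definition _ (z : R[i]) :=
  GRing.isLinear.Build R[i] X X *:%R (resolvent z) (@resolvent_linear z).

Lemma resolvent_bdd z : regular z ->
  exists2 C : R, 0 < C & forall x, nm (resolvent z x) <= C * nm x.
Proof.
move=> /resolventP [_ _ [C hC]]; exists (`|C| + 1); first by have := normr_ge0 C; lra.
move=> x; apply: le_trans (hC x) _; apply: ler_wpM2r; first exact: nm_ge0.
by have := ler_norm C; lra.
Qed.

Lemma resolvent_T z x : regular z -> resolvent z (T x) = x + z *: resolvent z x.
Proof.
move=> rz; have -> : T x = opshift T z x + z *: x by rewrite /opshift subrK.
by rewrite linearD linearZ /= resolventK.
Qed.

Lemma resolvent_opshift z a x : regular z ->
  resolvent z (opshift T a x) = x + (z - a) *: resolvent z x.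
Proof.
move=> rz; rewrite (opshift_opshift T a z) linearD linearZ /= resolventK //.
Qed.

Lemma opshift_resolvent z a x : regular z ->
  opshift T a (resolvent z x) = x + (z - a) *: resolvent z x.
Proof. by move=> rz; rewrite (opshift_opshift T a z) opshiftK. Qed.

Lemma iter_opshift_resolvent z a k x : regular z ->
  iter k (opshift T a) (resolvent z x) = resolvent z (iter k (opshift T a) x).
Proof.
by move=> rz; elim: k => //= k ->; rewrite opshift_resolvent // resolvent_opshift.
Qed.
End Resolvent.

Section RegularFilter.
Variables (R : realType) (X : normedModType R[i]) (T : {linear X -> X}).

Lemma regular_ultrafilter (lam : R[i]) :
  (forall d, 0 < d -> exists2 z, regular T z & nm (z - lam) < d) ->
  exists U : set_system R[i], UltraFilter U /\
    forall d, 0 < d -> U [set z | regular T z /\ nm (z - lam) < d].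
Proof.
move=> h.
pose F : set_system R[i] := [set A | exists2 d : R, 0 < d &
  [set z | regular T z /\ nm (z - lam) < d] `<=` A].
have FF : ProperFilter F.
  apply: Build_ProperFilter_ex.
    by move=> A [d d0 dA]; have [z rz zd] := h d d0; exists z; apply: dA.
  split; first by exists 1.
  - move=> A B [d d0 dA] [d' d'0 dB]; exists (Num.min d d').
      by rewrite lt_min d0.
    by move=> z [rz]; rewrite lt_min => /andP[z1 z2]; split; [apply: dA|apply: dB].
  - by move=> A B AB [d d0 dA]; exists d => //; apply: subset_trans AB.
have [U [UU sU]] := ultraFilterLemma FF.
by exists U; split => // d d0; apply: sU; exists d.
Qed.
End RegularFilter.

(** * Eigenfunctionals on the closed span of a Jordan chain *)

Section Chain.
Variables (R : realType) (X : completeNormedModType R[i]) (T : {linear X -> X}).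
Variables (lam : R[i]) (x : nat -> X) (CT eps : R).
Hypothesis TC : forall y, nm (T y) <= CT * nm y.
Hypothesis eps0 : 0 < eps.
Hypothesis x0 : x 0%N != 0.
Hypothesis Sx0 : opshift T lam (x 0%N) = 0.
Hypothesis SxS : forall n, opshift T lam (x n.+1) = x n.
Hypothesis reg : forall d, 0 < d -> exists2 z, regular T z & nm (z - lam) < d.

(** The closed linear span of the chain, as an intersection, so that closed linear conditions need
    only be checked on the [x n]. *)
Let Y : set X := [set y | forall V, linear_subspace V -> eclosed V ->
  (forall n, V (x n)) -> V y].

Let YS : linear_subspace Y.
Proof.
split; first by move=> V [].
split=> [y y' Yy Yy'|a y Yy] V VS Vc Vx; have [_ [VD VZ]] := VS.
  by apply: VD; [apply: Yy|apply: Yy'].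
by apply: VZ; apply: Yy.
Qed.

Let YC : eclosed Y.
Proof.
by move=> y hy V VS Vc Vx; apply: (Vc) => e e0; have [y' Yy' yy'] := hy e e0; exists y' => //; apply: Yy'.
Qed.

Let Yx n : Y (x n). Proof. by move=> V _ _; apply. Qed.

Let Y_stable (A : {linear X -> X}) C : 0 < C -> (forall y, nm (A y) <= C * nm y) ->
  (forall n, Y (A (x n))) -> forall y, Y y -> Y (A y).
Proof.
move=> C0 AC Ax y Yy; apply: (Yy [set y | Y (A y)]) => //.
  have [Y0 [YD YZ]] := YS; split; first by rewrite /= linear0.
  by split => [a b Ya Yb|t a Ya]; rewrite /= ?linearD ?linearZ; [apply: YD|apply: YZ].
move=> a ha; apply: YC => e e0; have [|b Yb ab] := ha (e / C); first exact: divr_gt0.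
exists (A b) => //; rewrite -linearB; apply: le_lt_trans (AC _) _.
by move: ab; rewrite ltr_pdivlMr // mulrC.
Qed.

Let TY y : Y y -> Y (T y).
Proof.
apply: (@Y_stable _ (`|CT| + 1)); first by have := normr_ge0 CT; lra.
  move=> a; apply: le_trans (TC a) _; apply: ler_wpM2r; first exact: nm_ge0.
  by have := ler_norm CT; lra.
have [Y0 [YD YZ]] := YS; move=> n.
have -> : T (x n) = opshift T lam (x n) + lam *: x n by rewrite /opshift subrK.
apply: YD; last exact: YZ.
by case: n => [|n]; rewrite ?Sx0 // SxS.
Qed.

Let neq z : regular T z -> z - lam != 0.
Proof.
move=> rz; rewrite subr_eq0; apply: contra x0 => /eqP zl.
by rewrite -(resolventK (x 0%N) rz) zl Sx0 linear0.
Qed.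

Let res_x0 z : regular T z -> resolvent T z (x 0%N) = - (z - lam)^-1 *: x 0%N.
Proof.
move=> rz; have := resolvent_opshift lam (x 0%N) rz; rewrite Sx0 linear0.
move=> /esym/eqP; rewrite addr_eq0 => /eqP xE; rewrite {2}xE.
by rewrite scalerN scaleNr opprK scalerA mulVf ?scale1r // neq.
Qed.

Let RY z : regular T z -> forall y, Y y -> Y (resolvent T z y).
Proof.
move=> rz; have [C C0 RC] := resolvent_bdd rz; have [Y0 [YD YZ]] := YS.
apply: (Y_stable C0 RC); elim => [|n /= IH]; first by rewrite /= res_x0 //; apply: YZ.
have h := resolvent_opshift lam (x n.+1) rz; rewrite SxS in h.
have -> : resolvent T z (x n.+1) =
    (z - lam)^-1 *: (resolvent T z (x n) - x n.+1).
  by rewrite h [x n.+1 + _]addrC addrK scalerA mulVf ?scale1r // neq.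
by apply: (YZ); apply: YD => //; rewrite -scaleN1r; apply: (YZ).
Qed.

Lemma perturbed_chain : perturbed_half_space T eps.
Proof.
have [U [UU Ureg]] := regular_ultrafilter reg.
have UP : ProperFilter U by exact: ultra_proper.
have [f [fl [Cf fC] fx0]] := separating_functional x0.
have nx0 : 0 < nm (x 0%N) by rewrite nm_gt0.
have [Y0 [YD YZ]] := YS.
(* [s] is the norm of [f \o resolvent T z] on [Y]. Testing it on the normalised [x 0] bounds it
   below by [(nm (z - lam) * nm (x 0))^-1], so it blows up at [lam] and [c z = 1 / s z] tends to
   0. *)
have norms z : exists s : R, regular T z -> [/\ nm (z - lam) * nm (x 0%N) >= s^-1,
    0 < s, forall y, Y y -> nm (f (resolvent T z y)) <= s * nm y &
    exists w, [/\ Y w, nm w <= 1 & s * (9 / 10) <= nm (f (resolvent T z w))]].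
  have [rz|] := pselect (regular T z); last by exists 0.
  have [C C0 RC] := resolvent_bdd rz.
  pose w0 := ((nm (x 0%N))^-1)%:C *: x 0%N.
  have nz : 0 < nm (z - lam) by rewrite nm_gt0 neq.
  have nw0 : nm w0 = 1.
    by rewrite nmZ nm_real ger0_norm ?invr_ge0 ?nm_ge0 // mulVf // gt_eqF.
  have pw0 : nm (f (resolvent T z w0)) = (nm (z - lam) * nm (x 0%N))^-1.
    rewrite /w0 linearZ /= res_x0 // scalerA (scalar_Z fl) fx0 mulr1 nmM nmN nmV nm_real.
    by rewrite ger0_norm ?invr_ge0 ?nm_ge0 // invfM mulrC.
  have pw0' : 0 < nm (f (resolvent T z w0)) by rewrite pw0 invr_gt0 mulr_gt0.
  have [] := @near_norm R X Y (fun y => nm (f (resolvent T z y))) (`|Cf| * C) w0 YZ _ _ _ _ pw0'.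
  - by move=> a y; rewrite linearZ /= (scalar_Z fl) nmM.
  - move=> y _; apply: le_trans (fC _) _; rewrite -mulrA.
    apply: le_trans (_ : `|Cf| * nm (resolvent T z y) <= _).
      by apply: ler_wpM2r; [apply: nm_ge0|apply: ler_norm].
    by apply: ler_wpM2l.
  - exact: YZ.
  - by rewrite nw0.
  move=> s [s1 s2 s3]; exists s => _; have sp : 0 < s by apply: lt_le_trans s1.
  split => //; rewrite -[leRHS]invrK -pw0 lef_pV2 ?posrE //.
have [s hs] := choice norms.
pose g z y := if `[< regular T z >] then ((s z)^-1)%:C * f (resolvent T z y) else 0.
pose c z : R[i] := if `[< regular T z >] then ((s z)^-1)%:C else 0.
have gl z : scalar (g z).
  move=> t a b; rewrite /g; case: asboolP => _; last by rewrite mulr0 addr0.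
  by rewrite linearP fl; ring.
have nms z : regular T z -> nm ((s z)^-1)%:C = (s z)^-1.
  by move=> rz; have [_ s0 _ _] := hs z rz; rewrite nm_real ger0_norm ?invr_ge0 ?(ltW s0).
have g1 z y : Y y -> nm (g z y) <= nm y.
  rewrite /g; case: asboolP => rz Yy; last by rewrite nm0 nm_ge0.
  have [_ s0 sb _] := hs z rz; rewrite nmM nms // ler_pdivrMl //; exact: sb.
have c0 : ulim U c 0.
  move=> e e0; have d0 : 0 < e / nm (x 0%N) by apply: divr_gt0.
  apply: filterS (Ureg _ d0) => z /= [rz zl]; rewrite subr0 /c; case: asboolP => // _.
  rewrite nms //; have [h _ _ _] := hs z rz; apply: le_lt_trans h _.
  by move: zl; rewrite ltr_pdivlMr.
have gT z y : Y y -> g z (T y) = z * g z y + c z * f y.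
  move=> _; rewrite /g /c; case: asboolP => rz; last by rewrite mulr0 mul0r addr0.
  by rewrite resolvent_T // (scalar_D fl) (scalar_Z fl); ring.
(* In the limit the [g z] are annihilated by [opshift T lam], and every [x n] is in its range;
   boundedness then carries this over to all of [Y]. *)
have gx n : ulim U (g^~ (x n)) 0.
  move=> e e0; have nx := nm_ge0 (x n.+1); have nf := nm_ge0 (f (x n.+1)).
  have d0 : 0 < e / (2 * (nm (x n.+1) + 1)) by apply: divr_gt0 => //; apply: mulr_gt0 => //; lra.
  have d1 : 0 < e / (2 * (nm (f (x n.+1)) + 1)) by apply: divr_gt0 => //; apply: mulr_gt0 => //; lra.
  apply: filterS (filterI (Ureg _ d0) (c0 _ d1)) => z /= [[rz zl] cz]; rewrite subr0.
  have -> : g z (x n) = (z - lam) * g z (x n.+1) + c z * f (x n.+1).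
    rewrite -SxS /opshift (scalar_B (gl z)) (scalar_Z (gl z)) gT //; ring.
  apply: le_lt_trans (nmD _ _) _; rewrite !nmM.
  move: zl cz; rewrite subr0 !ltr_pdivlMr; try by apply: mulr_gt0 => //; lra.
  have := g1 z (x n.+1) (@Yx n.+1); have := nm_ge0 (z - lam); have := nm_ge0 (c z).
  have := nm_ge0 (g z (x n.+1)); nra.
have gy y : Y y -> ulim U (g^~ y) 0.
  move=> Yy; suff [] : [set y | Y y /\ ulim U (g^~ y) 0] y by [].
  apply: Yy => [||n]; last by split; [apply: Yx|apply: gx].
  - split; first by split => // e e0; apply: filterS filterT => z _ /=; rewrite (scalar_0 (gl z)) subrr nm0.
    split => [a b [Ya ua] [Yb ub]|t a [Ya ua]]; split.
    + exact: YD.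
    + have := ulimD UP ua ub; rewrite addr0 => h; apply: (ulim_ext _ h) => z.
      by rewrite (scalar_D (gl z)).
    + exact: YZ.
    + have := ulimZ UP t ua; rewrite mulr0 => h; apply: (ulim_ext _ h) => z.
      by rewrite (scalar_Z (gl z)).
  - move=> a ha; have Ya : Y a.
      by apply: YC => e e0; have [b [Yb _] ab] := ha e e0; exists b.
    split => // e e0; have e2 : 0 < e / 2 by lra.
    have [b [Yb ub] ab] := ha _ e2; apply: filterS (ub _ e2) => z /=; rewrite !subr0 => gb.
    have := g1 z (a - b) (linear_subspace_B YS Ya Yb); rewrite (scalar_B (gl z)).
    by have := nm_sub (g z a) (g z b); lra.
have half0 : 0 < (1 / 2 : R) by lra.
apply: (@perturbed_eigenfunctionals R X T Y R[i] U UU g f id c eps (1/2) Cf) => //.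
move=> A UA; have [z [Az [rz _]]] := filter_ex (filterI UA (Ureg 1 ltr01)).
have [_ s0 _ [w [Yw w1 sw]]] := hs z rz.
have e4 : 0 < (1 / 4 : R) by lra.
have [z' [Az' /= gz']] := filter_ex (filterI UA (gy w Yw _ e4)).
exists z, z', w; split => //.
have : 9 / 10 <= nm (g z w).
  rewrite /g; case: asboolP => // _; rewrite nmM nms // -ler_pdivrMl ?invr_gt0 //.
  by rewrite invrK.
by move: gz'; rewrite subr0; have := nm_sub (g z w) (g z' w); lra.
Qed.
End Chain.

(** * Stable kernels *)

Section StableKernel.
Variables (R : realType) (X : completeNormedModType R[i]) (T : {linear X -> X}).
Variables (lam : R[i]) (k : nat) (CT eps : R).
Hypothesis TC : forall y, nm (T y) <= CT * nm y.
Hypothesis eps0 : 0 < eps.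
Local Notation S := (opshift T lam).
Hypothesis stable : forall x, iter k.+1 S x = 0 -> iter k S x = 0.
Hypothesis wild : forall d K, 0 < d -> exists z x,
  [/\ regular T z, nm (z - lam) < d & K * nm x < nm (resolvent T z (iter k S x))].

Let M : set X := [set x | iter k S x = 0].

Let MS : linear_subspace M.
Proof.
split; first by rewrite /M /= linear0.
by split => [a b|t a]; rewrite /M /= ?linearD ?linearZ /= => ->;
  [move=> ->; rewrite addr0|rewrite scaler0].
Qed.

Let S_M x : M x -> M (S x).
Proof. by rewrite /M /= -iterSr /= => ->; rewrite linear0. Qed.

Let T_M x : M x -> M (T x).
Proof.
move=> Mx; have [_ [MD MZ]] := MS.
have -> : T x = S x + lam *: x by rewrite /opshift subrK.
by apply: (MD); [apply: S_M|apply: (MZ)].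
Qed.

Let MC : eclosed M.
Proof.
have [C C0 hC] := iter_opshift_bdd lam k TC.
move=> x hx; apply: nm_eps0 => e e0.
have [|m Mm xm] := hx (e / C); first exact: divr_gt0.
have -> : iter k S x = iter k S (x - m) by rewrite linearB /= Mm subr0.
by apply: le_trans (hC _) _; move: xm; rewrite ltr_pdivlMr // mulrC => /ltW.
Qed.

(** Operators of norm at least [4 ^+ n] are chosen so that the factor [3^-1 ^+ n] lost in the
    gliding hump still leaves growth [(4/3)^n]; hence the whole sequence tends to infinity, not just
    a subsequence. *)
Lemma blow_up_sequence : exists (z : nat -> R[i]) (e : X),
  [/\ forall n, regular T (z n), forall d, 0 < d -> exists N, forall n, (N <= n)%N -> nm (z n - lam) < d &
    forall K, exists N, forall n, (N <= n)%N -> K < nm (resolvent T (z n) (iter k S e))].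
Proof.
have hz n : exists zx : R[i] * X, [/\ regular T zx.1, nm (zx.1 - lam) < 2^-1 ^+ n &
    4 ^+ n * nm zx.2 < nm (resolvent T zx.1 (iter k S zx.2))].
  have p0 : 0 < (2^-1 : R) ^+ n by apply: exprn_gt0.
  by have [z [x [h1 h2 h3]]] := wild (4 ^+ n) p0; exists (z, x).
have [zx hzx] := choice hz; pose z n := (zx n).1.
have hs n : exists sw : R * X, [/\ 4 ^+ n <= sw.1,
    forall x, nm (resolvent T (z n) (iter k S x)) <= sw.1 * nm x, nm sw.2 <= 1 &
    sw.1 * (9/10) <= nm (resolvent T (z n) (iter k S sw.2))].
  have [rz _ hx] := hzx n; set x := (zx n).2 in hx.
  have x0 : x != 0.
    by apply/negP => /eqP x0; move: hx; rewrite x0 nm0 mulr0 !linear0 nm0 ltxx.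
  have nx : 0 < nm x by rewrite nm_gt0.
  pose w0 := ((nm x)^-1)%:C *: x.
  have nw0 : nm w0 = 1.
    by rewrite nmZ nm_real ger0_norm ?invr_ge0 ?nm_ge0 // mulVf // gt_eqF.
  have pw0 : 4 ^+ n < nm (resolvent T (z n) (iter k S w0)).
    rewrite !linearZ /= nmZ nm_real ger0_norm ?invr_ge0 ?nm_ge0 //.
    by rewrite ltr_pdivlMl // mulrC.
  have [C1 C10 hC1] := resolvent_bdd rz; have [C2 C20 hC2] := iter_opshift_bdd lam k TC.
  have p0 : 0 < nm (resolvent T (z n) (iter k S w0)).
    by apply: lt_trans pw0; apply: exprn_gt0.
  have [] := @near_norm R X setT (fun x => nm (resolvent T (z n) (iter k S x))) (C1 * C2) w0
    _ _ _ _ _ p0 => //.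
  - by move=> a y; rewrite !linearZ /= nmZ.
  - move=> y _; apply: le_trans (hC1 _) _; rewrite -mulrA.
    by apply: ler_wpM2l; [apply: ltW|apply: hC2].
  - by rewrite nw0.
  move=> s [s1 s2 [w [_ w1 sw]]]; exists (s, w); split => //=.
    by apply: le_trans (ltW pw0) s1.
  by move=> y; apply: s2.
have [sw hsw] := choice hs.
have [e he] := @gliding_hump R X (fun n x => nm (resolvent T (z n) (iter k S x)))
  (fun n => (sw n).1) (fun n => (sw n).2)
  (fun n x y => ltac:(rewrite /= !linearD; exact: nmD))
  (fun n a x => ltac:(rewrite /= !linearZ; exact: nmZ))
  (fun n x => ltac:(by have [_ h _ _] := hsw n; apply: h))
  (fun n => ltac:(by have [_ _ h _] := hsw n))
  (fun n => ltac:(by have [_ _ _ h] := hsw n)).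
exists z, e; split.
- by move=> n; have [] := hzx n.
- move=> d d0; have h01 : 0 <= (2^-1 : R) < 1 by lra.
  have [N HN] := exprn_small 1 h01 d0; exists N => n Nn.
  have [_ h _] := hzx n; apply: lt_trans h _.
  by have := HN n Nn; rewrite mul1r.
move=> K; have h01 : 0 <= (3 / 4 : R) < 1 by lra.
have e1 : 0 < 1 / (`|K| + 1) by apply: divr_gt0 => //; have := normr_ge0 K; lra.
have [N HN] := exprn_small (5 / 2) h01 e1; exists N => n Nn.
apply: lt_le_trans (he n); have [h4 _ _ _] := hsw n.
have p3 : 0 < (3^-1 : R) ^+ n by apply: exprn_gt0.
have p43 : (3 / 4 : R) ^+ n * (4 ^+ n * 3^-1 ^+ n) = 1.
  rewrite -!exprMn; have -> : (3 / 4 * (4 / 3) : R) = 1 by field.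
  by rewrite expr1n.
have q0 : 0 < 4 ^+ n * 3^-1 ^+ n :> R by apply: mulr_gt0 => //; apply: exprn_gt0.
have := HN n Nn; rewrite ltr_pdivlMr; last by have := normr_ge0 K; lra.
move=> h; apply: lt_le_trans (_ : 4 ^+ n * 3^-1 ^+ n * (2 / 5) <= _); last first.
  by apply: ler_wpM2r; [lra|apply: ler_wpM2r; [apply: ltW|]].
have := ler_norm K; set u := (3/4) ^+ n in h p43; set v := 4 ^+ n * 3^-1 ^+ n in p43 q0 *.
have : (5 / 2 * u * (`|K| + 1)) * v < 1 * v by rewrite ltr_pM2r.
have -> : 5 / 2 * u * (`|K| + 1) * v = 5 / 2 * (`|K| + 1) * (u * v) by ring.
by rewrite p43; lra.
Qed.

Lemma perturbed_stable_kernel : perturbed_half_space T eps.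
Proof.
have [z [e [zr zl zb]]] := blow_up_sequence.
have [C C0 hC] := iter_opshift_bdd lam k TC.
have [M0 [MD MZ]] := MS.
pose u n := resolvent T (z n) e; pose d n := dist_to M (u n).
(* [iter k S] kills [M], so its value on [u n] is at most [C] times the distance from [u n] to [M]:
   blow-up of the former forces blow-up in the quotient. *)
have d_big K : exists N, forall n, (N <= n)%N -> K < d n.
  have [N HN] := zb (C * (K + 1)); exists N => n Nn.
  suff : K + 1 <= d n by lra.
  apply: le_dist_to => // m Mm; have := HN n Nn.
  rewrite -iter_opshift_resolvent; last exact: zr.
  have -> : iter k (opshift T lam) (resolvent T (z n) e) = iter k S (u n - m).
    by rewrite linearB /= Mm subr0.
  move=> h; have := lt_le_trans h (hC (u n - m)).
  by rewrite ltr_pM2l // => /ltW.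
(* A nearest point of [M] need not exist. One within the factor 2 suffices: dividing by [2 * d n]
   puts [v n] in the unit ball at distance at least 1/2 from [M]. *)
have hm n : exists m, M m /\ (0 < d n -> nm (u n - m) <= 2 * d n).
  have [d0|d0] := ltP 0 (d n); last by exists 0.
  have [m Mm hm] := dist_to_adherent MS (u n) d0.
  by exists m; split => // _; rewrite -/(d n) in hm; lra.
have [m hm'] := choice hm.
pose t n : R[i] := ((2 * d n)^-1)%:C.
pose v n := t n *: (u n - m n).
have nt n : 0 < d n -> nm (t n) = (2 * d n)^-1.
  by move=> d0; rewrite nm_real ger0_norm // invr_ge0; lra.
have v1 n : nm (v n) <= 1.
  have [d0|d0] := ltP 0 (d n).
    rewrite nmZ nt // ler_pdivrMl ?mulr1; last by lra.
    by have [_ h] := hm' n; apply: h.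
  have dn0 : d n = 0 by apply/eqP; rewrite eq_le d0 dist_to_ge0.
  by rewrite nmZ /t dn0 mulr0 invr0 nm_real normr0 mul0r.
have vfar n m' : 0 < d n -> M m' -> 1 / 2 <= nm (v n - m').
  move=> d0 Mm'; have [Mmn _] := hm' n.
  have td : t n * (2 * d n)%:C = 1.
    by rewrite -rmorphM mulVf // gt_eqF //; lra.
  have -> : v n - m' = t n *: (u n - (m n + (2 * d n)%:C *: m')).
    by rewrite opprD addrA [in RHS]scalerBr scalerA td scale1r.
  rewrite nmZ nt //; have := dist_to_le MS (u n) (MD _ _ Mmn (MZ (2 * d n)%:C _ Mm')).
  rewrite -/(d n) => h; rewrite ler_pdivlMl; last by lra.
  by lra.
have Tv n : M (T (v n) - z n *: v n - t n *: e).
  have -> : T (v n) - z n *: v n - t n *: e = (- t n) *: opshift T (z n) (m n).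
    rewrite -/(opshift T (z n) (v n)) /v linearZ linearB /= opshiftK; last exact: zr.
    by rewrite scalerBr addrAC subrr sub0r scaleNr.
  apply: (MZ); rewrite /opshift -scaleNr; have [Mm _] := hm' n.
  by apply: (MD); [apply: T_M|apply: (MZ)].
have t_small a : 0 < a -> exists N, forall n, (N <= n)%N -> 0 < d n /\ nm (t n) < a.
  move=> a0; have [N HN] := d_big (a^-1); exists N => n Nn.
  have ai : 0 < a^-1 by rewrite invr_gt0.
  have d0 : 0 < d n by apply: lt_trans (HN n Nn).
  split => //; rewrite nt // -[X in _ < X]invrK ltf_pV2 ?posrE //; last by lra.
  by have := HN n Nn; lra.
have [U [UU Un]] := nat_ultrafilter.
have UP : ProperFilter U by exact: ultra_proper.
suff [delta [delta0 far]] : exists delta : R, 0 < delta /\ forall A, U A ->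
    exists i j, [/\ A i, A j & forall m, M m -> delta <= nm (v i - v j - m)].
  apply: (@perturbed_eigenvectors R X T M nat U UU v z t e eps delta CT TC MS) => //.
  move=> a a0; have [N HN] := t_small a a0; apply: filterS (Un N) => n Nn /=.
  by rewrite subr0; have [] := HN n Nn.
(* Otherwise a subsequence is Cauchy modulo M; its limit lies in ker S^(k+1)
   and hence in M, although its distance to M is at least 1/2. *)
apply: contrapT => nofar; exfalso.
have hA n : exists A, U A /\ forall i j, A i -> A j ->
    exists m', M m' /\ nm (v i - v j - m') < 2^-1 ^+ n.
  apply: contrapT => h; apply: nofar; exists (2^-1 ^+ n); split; first exact: exprn_gt0.
  move=> A UA; apply: contrapT => h'; apply: h; exists A; split => // i j Ai Aj.
  apply: contrapT => h''; apply: h'; exists i, j; split => // m' Mm'.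
  by rewrite leNgt; apply/negP => hlt; apply: h''; exists m'.
have [A hA'] := choice hA.
have UAn n : U [set i | forall l, (l <= n)%N -> A l i].
  elim: n => [|n IH]; first by apply: filterS (proj1 (hA' 0%N)) => i Ai l; rewrite leqn0 => /eqP ->.
  apply: filterS (filterI IH (proj1 (hA' n.+1))) => i /= [h1 h2] l.
  by rewrite leq_eqVlt => /orP[/eqP ->|] //; rewrite ltnS; apply: h1.
have hi n : exists i, [/\ forall l, (l <= n)%N -> A l i, 0 < d i, nm (t i) < 2^-1 ^+ n &
    nm (z i - lam) < 2^-1 ^+ n].
  have p0 : 0 < (2^-1 : R) ^+ n by apply: exprn_gt0.
  have [N1 H1] := t_small _ p0; have [N2 H2] := zl _ p0.
  have [i /= [[hi1 hi2] hi3]] := filter_ex (filterI (filterI (UAn n) (Un N1)) (Un N2)).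
  by have [h1 h2] := H1 i hi2; exists i; split => //; apply: H2.
have [i hi'] := choice hi.
have hmu n : exists m', M m' /\ nm (v (i n) - v (i n.+1) - m') < 2^-1 ^+ n.
  have [h _ _ _] := hi' n; have [h' _ _ _] := hi' n.+1.
  by apply: (proj2 (hA' n)); [apply: h|apply: h'].
have [mu hmu'] := choice hmu.
(* Summing the corrections from [M] lifts convergence modulo [M] to honest convergence of
   [v (i n) + r n] in [X]. *)
pose r := fix r n := if n is n'.+1 then r n' + mu n' else 0 : X.
have Mr n : M (r n).
  by elim: n => [|n IH] //=; apply: (MD) => //; have [] := hmu' n.
pose s n := v (i n) + r n.
have h01 : 0 <= (2^-1 : R) < 1 by lra.
have [l hl] := @series_limit R X s 1 _ h01 (fun n => ltac:(
  rewrite mul1r nmBC /s /=; have [_ /ltW +] := hmu' n;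
  by have -> : v (i n) + r n - (v (i n.+1) + (r n + mu n)) = v (i n) - v (i n.+1) - mu n
    by rewrite opprD addrACA opprD addNKr)).
(* [T (v (i N)) - z (i N) *: v (i N) - t (i N) *: e] and [S (r N)] are in [M]; their sum differs
   from [S (s N)] only by terms with the vanishing coefficients [z (i N) - lam] and [t (i N)]. *)
have nSl : M (S l).
  apply: MC => a a0.
  have CS x : nm (S x) <= (`|CT| + nm lam) * nm x.
    apply: le_trans (opshift_bdd lam TC _) _; apply: ler_wpM2r; first exact: nm_ge0.
    by have := ler_norm CT; lra.
  pose B := (`|CT| + nm lam) * (1 / (1 - 2^-1)) + 1 + nm e.
  have [N HN] := exprn_small B h01 a0; have {HN} := HN N (leqnn N) => HN.
  have [_ _ hi3 hi4] := hi' N.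
  exists (S (s N) - (z (i N) - lam) *: v (i N) - t (i N) *: e).
    have -> : S (s N) - (z (i N) - lam) *: v (i N) - t (i N) *: e =
      (T (v (i N)) - z (i N) *: v (i N) - t (i N) *: e) + S (r N).
      rewrite /s linearD /= {1}/opshift scalerBl.
      set p := T _; set p1 := lam *: _; set p2 := z _ *: _; set p3 := opshift _ _ _.
      by rewrite opprB [p - p1 + p3]addrAC addrA subrK (addrAC p) [LHS]addrAC.
    by apply: (MD) => //; apply: S_M.
  have -> : S l - (S (s N) - (z (i N) - lam) *: v (i N) - t (i N) *: e) =
    S (l - s N) + ((z (i N) - lam) *: v (i N) + t (i N) *: e).
    rewrite [opshift T lam (l - _)]linearB /=; set p := opshift _ _ l; set p1 := opshift _ _ _; set p2 := (_ - _) *: _.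
    by rewrite -[p1 - p2 - _]addrA -opprD opprB addrCA addrC.
  apply: le_lt_trans HN; apply: le_trans (nmD _ _) _; rewrite /B -addrA mulrDl.
  have c1 : 0 <= `|CT| + nm lam by have := nm_ge0 lam; have := normr_ge0 CT; lra.
  apply: lerD.
    by apply: le_trans (CS _) _; rewrite -mulrA; exact: (ler_wpM2l c1 (hl N)).
  apply: le_trans (nmD _ _) _; rewrite (nmZ _ (v (i N))) (nmZ _ e).
  have := v1 (i N); have := nm_ge0 (v (i N)); have := nm_ge0 (z (i N) - lam); have := nm_ge0 e.
  move=> ? ? ? ?; nra.
have Ml : M l by apply: stable; rewrite iterSr; apply: nSl.
have e1 : 0 < (1 / 2 : R) by lra.
have [N HN] := exprn_small (1 / (1 - 2^-1)) h01 e1.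
have := hl N; have := HN N (leqnn N); have [_ di _ _] := hi' N.
have := vfar (i N) (l - r N) di (linear_subspace_B MS Ml (Mr N)).
have -> : v (i N) - (l - r N) = s N - l by rewrite opprB addrA addrAC.
by rewrite nmBC; lra.
Qed.
End StableKernel.

(** * Liouville's theorem on a punctured plane *)

Section Liouville.
Variable R : realType.

Lemma avoid_seq (l : seq R) (a b : R) : a < b -> exists x, a < x < b /\ x \notin l.
Proof.
elim: l a b => [|y l IH] a b ab; first by exists ((a + b) / 2); split => //; lra.
have [h|h] := leP y ((a + b) / 2).
  have [|x [hx xl]] := IH ((a + b) / 2) b; first by lra.
  exists x; split; first by move: hx; lra.
  rewrite inE negb_or xl andbT; apply/eqP => xy; move: hx; rewrite xy; lra.
have [|x [hx xl]] := IH a ((a + b) / 2); first by lra.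
exists x; split; first by move: hx; lra.
rewrite inE negb_or xl andbT; apply/eqP => xy; move: hx; rewrite xy; lra.
Qed.

Lemma root_of_unity (d : R) : 0 < d -> exists (n : nat) (w : R[i]),
  [/\ (0 < n)%N, w ^+ n = 1, w != 1, nm w = 1 & nm (w - 1) <= d].
Proof.
move=> d0.
pose e (t : R) : R[i] := cos t +i* sin t.
have eX t n : e t ^+ n = e (n%:R * t).
  elim: n => [|n IH]; first by rewrite mul0r /e cos0 sin0.
  rewrite exprS IH -natr1 mulrDl mul1r addrC /e cosD sinD.
  by apply/eqP; rewrite eq_complex /=; apply/andP; split; apply/eqP; ring.
have d2 : 0 < d / 2 by lra.
have cc := @continuous_cos R 0; have cs := @continuous_sin R 0.
move/cvgrPdist_lt: cc => /(_ _ d2) [r1 /= r10 h1].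
move/cvgrPdist_lt: cs => /(_ _ d2) [r2 /= r20 h2].
have pi0 := pi_gt0 R.
have h01 : 0 <= (2^-1 : R) < 1 by lra.
have r0 : 0 < Num.min r1 r2 by rewrite lt_min r10.
have [N HN] := exprn_small pi h01 r0.
pose n := (2 ^ N.+1)%N; pose t : R := pi / n%:R.
have n1 : (1 < n)%N by rewrite /n -{1}(expn0 2) ltn_exp2l.
have n0 : 0 < n%:R :> R by rewrite ltr0n; apply: ltnW.
have t0 : 0 < t by apply: divr_gt0.
have tE : t = pi * 2^-1 ^+ N.+1 by rewrite /t /n natrX exprVn.
have tr : t < Num.min r1 r2 by rewrite tE; apply: HN.
have tpi : t < pi by rewrite /t ltr_pdivrMr // ltr_pMr // ltr1n.
exists (n + n)%N, (e t); split.
- by rewrite addn_gt0 (ltnW n1).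
- rewrite exprD eX (_ : n%:R * t = pi); last by rewrite /t mulrC divfK ?gt_eqF.
  rewrite /e cospi sinpi.
  by apply/eqP; rewrite eq_complex /=; apply/andP; split; apply/eqP; ring.
- apply/eqP => /(congr1 (@complex.Im R)) /= s0.
  have : 0 < sin t by apply: sin_gt0_pi; rewrite t0.
  by rewrite s0 ltxx.
- by rewrite /nm normc_def /= cos2Dsin2 sqrtr1.
- apply: le_trans (nm_le_ReIm _) _ => /=.
  move: tr; rewrite lt_min => /andP[tr1 tr2].
  have := h1 t; have := h2 t; rewrite /= !sub0r normrN ger0_norm ?(ltW t0) //.
  rewrite cos0 sin0 sub0r normrN oppr0 addr0 => /(_ tr2) a /(_ tr1); rewrite distrC.
  by lra.
Qed.

(* A discrete form of the mean value property on circles around [z0]: moving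
   radially costs the same, up to second order terms, as moving tangentially,
   and the tangential increments telescope to 0. *)
Lemma punctured_liouville (X : normedModType R[i]) (L : seq R[i])
  (P P' : R[i] -> X) (C : R) : 0 <= C ->
  (forall z z', z \notin L -> z' \notin L ->
    nm (P z' - P z - (z' - z) *: P' z) <= C * nm (z' - z) ^+ 2) ->
  (forall e, 0 < e -> exists r, forall z, z \notin L -> r <= nm z -> nm (P z) <= e) ->
  forall z, z \notin L -> P z = 0.
Proof.
move=> C0 hP decay z0 z0L; apply: nm_eps0 => e e0.
have e3 : 0 < e / 3 by lra.
have [r hr] := decay _ e3; pose R1 := `|r| + nm z0 + 1.
have R1_1 : 1 <= R1 by have := normr_ge0 r; have := nm_ge0 z0; rewrite /R1; lra.
pose B := C * (R1 + 1) ^+ 2 + 1.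
have B1 : 1 <= B by have := sqr_ge0 (R1 + 1); rewrite /B => ?; nra.
have d0 : 0 < e / (3 * B) by apply: divr_gt0 => //; lra.
have [n [w [n0 wn w1 nw wd]]] := root_of_unity d0.
have h01 : 0 <= (2^-1 : R) < 1 by lra.
have [N HN] := exprn_small 1 h01 d0; pose m := (2 ^ N)%N.
have m0 : 0 < m%:R :> R by rewrite ltr0n expn_gt0.
have md : (m%:R)^-1 <= e / (3 * B).
  by have := HN N (leqnn N); rewrite mul1r exprVn /m natrX => /ltW.
(* The finitely many radii for which a grid point could meet [L]: [z i j = a] forces
   [rho = m * nm (a - z0) / i]. *)
pose bad := [seq m%:R * nm (a - z0) / i%:R | a <- L, i <- iota 1 m].
have R12 : R1 < R1 + 1 by rewrite ltrDl.
have [rho [/andP[rho1 rho2] rhobad]] := avoid_seq bad R12.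
have rho0 : 0 < rho by lra.
pose h := rho / m%:R; have h0 : 0 < h by apply: divr_gt0.
pose z (i j : nat) := z0 + (i%:R * h)%:C * w ^+ j.
have nwj j : nm (w ^+ j) = 1 by rewrite nmX nw expr1n.
have zL i j : (i <= m)%N -> z i j \notin L.
  move=> im; apply/negP => zL; move: rhobad; apply/negP; rewrite negbK.
  case: i im zL => [|i] im zL.
    by move: zL; rewrite /z mul0r mul0r addr0 (negbTE z0L).
  apply/allpairsP; exists (z i.+1 j, i.+1); split => //=.
    by rewrite mem_iota add1n /= ltnS.
  rewrite /z addrAC subrr add0r nmM nwj mulr1 nm_real ger0_norm; last first.
    by apply: mulr_ge0 => //; apply: ltW.
  by rewrite /h; field; rewrite !gt_eqF ?ltr0n // expn_gt0.
have zper i : z i n = z i 0%N by rewrite /z wn expr0.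
pose av i := \sum_(j < n) P (z i j).
have n0R : 0 < n%:R :> R by rewrite ltr0n.
have w10 : 0 < nm (w - 1) by rewrite nm_gt0 subr_eq0.
have sum_const (c : R) : \sum_(j < n) c = n%:R * c.
  by rewrite sumr_const card_ord mulr_natl.
(* Every tangential step is [q * (w - 1)] times [w ^+ j]. Dividing by this common factor leaves one
   power of the step length in the error, and the weights [w ^+ j] are those of the radial steps. *)
have tang i : (i < m)%N ->
    nm (\sum_(j < n) w ^+ j *: P' (z i.+1 j)) <= n%:R * C * (rho * nm (w - 1)).
  move=> im; set D := \sum_(_ < _) _; pose q : R := i.+1%:R * h.
  have q0 : 0 < q by apply: mulr_gt0 => //; rewrite ltr0n.
  have qrho : q <= rho.
    rewrite /q /h mulrCA ger_pMr // ler_pdivrMr // mul1r ler_nat //.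
  have zd j : z i.+1 j.+1 - z i.+1 j = (q%:C * (w - 1)) * w ^+ j.
    by rewrite /z -/q exprS; ring.
  have tele : \sum_(j < n) (P (z i.+1 j.+1) - P (z i.+1 j)) = 0.
    rewrite -(big_mkord xpredT (fun j => P (z i.+1 j.+1) - P (z i.+1 j))).
    by rewrite telescope_sumr // zper subrr.
  have : nm ((q%:C * (w - 1)) *: D) <= n%:R * (C * (q * nm (w - 1)) ^+ 2).
    rewrite -nmN -[X in nm X]add0r -tele scaler_sumr -sumrB -sum_const.
    apply: le_trans (nm_sum _) _; apply: ler_sum => j _.
    have := hP _ _ (zL i.+1 j im) (zL i.+1 j.+1 im).
    by rewrite scalerA zd !nmM nwj mulr1 nm_real ger0_norm // ltW.
  rewrite nmZ nmM nm_real ger0_norm ?(ltW q0) //.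
  have -> : n%:R * (C * (q * nm (w - 1)) ^+ 2) =
    (q * nm (w - 1)) * (n%:R * C * (q * nm (w - 1))) by ring.
  rewrite ler_pM2l; last exact: mulr_gt0.
  move=> /le_trans; apply; apply: ler_wpM2l; first by apply: mulr_ge0 => //; apply: ltW.
  by apply: ler_wpM2r => //; apply: ltW.
have step i : (i < m)%N ->
    nm (av i - av i.+1) <= n%:R * C * h * (h + rho * nm (w - 1)).
  move=> im.
  have zd j : z i j - z i.+1 j = - h%:C * w ^+ j.
    by rewrite /z -natr1 mulrDl mul1r rmorphD /=; ring.
  have -> : av i - av i.+1 = \sum_(j < n) (P (z i j) - P (z i.+1 j)
      - (z i j - z i.+1 j) *: P' (z i.+1 j)) - h%:C *: \sum_(j < n) w ^+ j *: P' (z i.+1 j).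
    rewrite scaler_sumr -!sumrB; apply: eq_bigr => j _.
    by rewrite zd mulNr scaleNr opprK scalerA addrK.
  apply: le_trans (nmB _ _) _; rewrite mulrDr; apply: lerD.
    apply: le_trans (nm_sum _) _.
    have -> : n%:R * C * h * h = \sum_(j < n) (C * h ^+ 2) by rewrite sum_const; ring.
    apply: ler_sum => j _; have := hP _ _ (zL i.+1 j im) (zL i j (ltnW im)).
    by rewrite [in X in _ <= X]zd nmM nmN nwj mulr1 nm_real ger0_norm // ltW.
  rewrite nmZ nm_real ger0_norm ?(ltW h0) //.
  by have := ler_wpM2l (ltW h0) (tang i im); lra.
have all i : (i <= m)%N -> nm (av 0%N - av i) <= i%:R * (n%:R * C * h * (h + rho * nm (w - 1))).
  elim: i => [|i IH] im; first by rewrite subrr nm0 mul0r.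
  apply: le_trans (nm_tri (av i) _ _) _; rewrite -natr1 mulrDl mul1r.
  by apply: lerD; [apply: IH; apply: ltnW|apply: step].
have av0 : av 0%N = n%:R *: P z0.
  rewrite /av (eq_bigr (fun=> P z0)) => [|j _]; last by rewrite /z mul0r mul0r addr0.
  by rewrite sumr_const card_ord scaler_nat.
have avm : nm (av m) <= n%:R * (e / 3).
  rewrite -sum_const; apply: le_trans (nm_sum _) _; apply: ler_sum => j _.
  apply: hr; first exact: zL.
  have -> : z m j = rho%:C * w ^+ j - - z0.
    by rewrite /z /h mulrCA divff ?gt_eqF // mulr1 opprK addrC.
  apply: le_trans (nm_sub _ _); rewrite nmM nwj mulr1 nm_real ger0_norm ?(ltW rho0) // nmN.
  by have := ler_norm r; rewrite /R1 in rho1; lra.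
have := all m (leqnn m); have := nm_sub (av 0%N) (av m); rewrite av0 nmZ.
have -> : nm (n%:R : R[i]) = n%:R.
  by rewrite -(rmorph_nat (real_complex R)) nm_real ger0_norm.
have -> : m%:R * (n%:R * C * h * (h + rho * nm (w - 1))) =
  n%:R * (C * rho * (rho * ((m%:R)^-1 + nm (w - 1)))).
  by rewrite /h; field; rewrite gt_eqF.
have hB : C * rho * (rho * ((m%:R)^-1 + nm (w - 1))) <= B * (2 * (e / (3 * B))).
  have h1 : 0 <= (m%:R : R)^-1 + nm (w - 1) by apply: addr_ge0; [rewrite invr_ge0 ltW|apply: ltW].
  have h2 : C * rho * rho <= B by rewrite /B; have : 0 <= rho * rho <= (R1 + 1) ^+ 2 by [nra]; nra.
  rewrite [C * rho * _]mulrA; apply: le_trans (ler_wpM2r h1 h2) _; apply: ler_wpM2l; first by lra.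
  by lra.
have eB : B * (2 * (e / (3 * B))) = 2 * (e / 3) by field; rewrite gt_eqF //; lra.
rewrite eB in hB.
move=> h1 h2; have h4 : n%:R * nm (P z0) <= n%:R * e.
  by have := ler_wpM2l (ltW n0R) hB; lra.
by move: h4; rewrite ler_pM2l.
Qed.
End Liouville.

(** * The regular set *)

Section RegularSet.
Variables (R : realType) (X : completeNormedModType R[i]) (T : {linear X -> X}).
Variable CT : R.
Hypothesis CT0 : 0 <= CT.
Hypothesis TC : forall y, nm (T y) <= CT * nm y.

Lemma neumann (A : {linear X -> X}) (q : R) : 0 <= q < 1 ->
  (forall x, nm (A x) <= q * nm x) -> forall x, exists y, y - A y = x.
Proof.
move=> q01 Aq x; have q0 : 0 <= q by case/andP: q01.
pose u := fix u n := if n is n'.+1 then x + A (u n') else 0 : X.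
have hu n : nm (u n.+1 - u n) <= nm x * q ^+ n.
  elim: n => [|n IH]; first by rewrite /= linear0 addr0 subr0 expr0 mulr1.
  have -> : u n.+2 - u n.+1 = A (u n.+1 - u n).
    by rewrite linearB /= opprD addrACA subrr add0r.
  apply: le_trans (Aq _) _; rewrite exprS mulrCA; exact: ler_wpM2l.
have [y hy] := series_limit q01 hu; exists y.
have [b Hb] : exists b, forall n, nm (y - u n) <= b * q ^+ n by exists (nm x / (1 - q)).
apply/eqP; rewrite -subr_eq0; apply/eqP; apply: nm_eps0 => e e0.
have [N HN] := exprn_small (2 * b) q01 e0.
have -> : y - A y - x = (y - u N.+1) - A (y - u N).
  by rewrite linearB /= opprB opprD !addrA subrK addrAC.
apply: le_trans (nmB _ _) _; have := Hb N.+1; have := Aq (y - u N); have := Hb N.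
have := HN N (leqnn N); have := HN N.+1 (leqnSn N).
have := nm_ge0 (y - u N); case/andP: q01 => _; nra.
Qed.

Lemma regular_intro z (K : R) : (forall x, exists y, opshift T z y = x) ->
  (forall y, nm y <= K * nm (opshift T z y)) ->
  regular T z /\ forall x, nm (resolvent T z x) <= K * nm x.
Proof.
move=> surj lower; have [r hr] := choice surj.
have rz : regular T z.
  exists r; split => // [x|]; last by exists K => y; rewrite -{2}(hr y).
  apply/eqP; rewrite -subr_eq0 -nm_eq0 eq_le nm_ge0 andbT.
  by have := lower (r (opshift T z x) - x); rewrite linearB /= hr subrr nm0 mulr0.
by split => // x; rewrite -{2}(opshiftK x rz).
Qed.

Lemma regular_far z : CT < nm z ->
  regular T z /\ forall x, nm (resolvent T z x) <= (nm z - CT)^-1 * nm x.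
Proof.
move=> zC; have d0 : 0 < nm z - CT by rewrite subr_gt0.
have nz : 0 < nm z by apply: le_lt_trans zC.
have z0 : z != 0 by rewrite -nm_gt0.
apply: regular_intro => [x|y]; last first.
  rewrite ler_pdivlMl // mulrBl; have := nm_sub (z *: y) (T y).
  by rewrite nmZ nmBC -/(opshift T z y); have := TC y; lra.
have Al : linear (fun y => z^-1 *: T y).
  by move=> t a b; rewrite linearP scalerDr !scalerA mulrC.
pose A : {linear X -> X} := HB.pack (fun y => z^-1 *: T y)
  (GRing.isLinear.Build _ _ _ _ (fun y => z^-1 *: T y) Al).
have [||y hy] := @neumann A ((nm z)^-1 * CT) _ _ (- z^-1 *: x).
- apply/andP; split; first by apply: mulr_ge0 => //; rewrite invr_ge0 ltW.
  by rewrite ltr_pdivrMl // mulr1.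
- by move=> y; rewrite /A /= nmZ nmV -mulrA; apply: ler_wpM2l => //; rewrite invr_ge0 ltW.
exists y; move: hy; rewrite /A /= => hy; rewrite /opshift.
have -> : T y - z *: y = - z *: (y - z^-1 *: T y).
  by rewrite scalerBr scalerA mulNr divff // !scaleNr scale1r opprK addrC.
by rewrite hy scalerA mulrNN divff // scale1r.
Qed.

(** Neumann series for [R_{z0} (T - z) = 1 - (z - z0) R_{z0}]. *)
Lemma regular_near z z0 (K : R) : 0 <= K -> regular T z0 ->
  (forall x, nm (resolvent T z0 x) <= K * nm x) -> K * nm (z - z0) < 1 ->
  regular T z.
Proof.
move=> K0 r0 hK q1; set q := K * nm (z - z0) in q1.
have q01 : 0 <= q < 1 by rewrite q1 andbT; apply: mulr_ge0 => //; apply: nm_ge0.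
have d0 : 0 < 1 - q by rewrite subr_gt0.
pose A' y := (z - z0) *: resolvent T z0 y.
have Al : linear A'.
  by move=> t a b; rewrite /A' linearP scalerDr !scalerA mulrC.
pose A : {linear X -> X} := HB.pack A' (GRing.isLinear.Build _ _ _ _ A' Al).
have Aq x : nm (A x) <= q * nm x.
  have -> : q * nm x = nm (z - z0) * (K * nm x) by rewrite /q; ring.
  by rewrite /A /= nmZ; apply: ler_wpM2l => //; apply: nm_ge0.
have key y : resolvent T z0 (opshift T z y) = y - A y.
  by rewrite resolvent_opshift // /A /= /A' -opprB scaleNr.
suff [] : regular T z /\ forall x, nm (resolvent T z x) <= K / (1 - q) * nm x by [].
apply: regular_intro => [x|y].
  have [y hy] := neumann q01 Aq (resolvent T z0 x); exists y.
  by rewrite -(opshiftK (opshift T z y) r0) key hy opshiftK.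
rewrite mulrAC ler_pdivlMr // mulrBr mulr1; have := hK (opshift T z y); rewrite key.
by have := Aq y; have := nm_sub y (A y); lra.
Qed.

Lemma polyop_cat s t x : polyop T (s ++ t) x = polyop T s (polyop T t x).
Proof. by rewrite /polyop foldr_cat. Qed.

Lemma opshift_comm a b x : opshift T a (opshift T b x) = opshift T b (opshift T a x).
Proof.
by rewrite /opshift !linearB !linearZ /= !scalerA [b * a]mulrC addrACA.
Qed.

Lemma polyop_opshift s a x : polyop T s (opshift T a x) = opshift T a (polyop T s x).
Proof. by elim: s => //= b s ->; rewrite opshift_comm. Qed.

Lemma polyop_comm s t x : polyop T s (polyop T t x) = polyop T t (polyop T s x).
Proof. by elim: t => //= b t <-; rewrite polyop_opshift. Qed.

Lemma polyop_nseq k a x : polyop T (nseq k a) x = iter k (opshift T a) x.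
Proof. by elim: k => //= k ->. Qed.

Lemma polyop_bdd s : exists2 C : R, 0 < C & forall x, nm (polyop T s x) <= C * nm x.
Proof.
elim: s => [|a s [C C0 IH]]; first by exists 1 => // x; rewrite mul1r.
have p0 : 0 < CT + nm a + 1 by rewrite ltr_wpDl ?addr_ge0 ?nm_ge0.
exists ((CT + nm a + 1) * C); first exact: mulr_gt0.
move=> x /=; apply: le_trans (opshift_bdd a TC _) _; rewrite -mulrA.
apply: le_trans (_ : (CT + nm a + 1) * nm (polyop T s x) <= _).
  by apply: ler_wpM2r; [exact: nm_ge0|lra].
by apply: ler_wpM2l => //; apply: ltW.
Qed.

Lemma resolvent_polyop z s x : regular T z ->
  resolvent T z (polyop T s x) = polyop T s (resolvent T z x).
Proof.
move=> rz; elim: s => //= a s IH; by rewrite resolvent_opshift // -IH opshift_resolvent.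
Qed.

Lemma resolvent_identity z z' x : regular T z -> regular T z' ->
  resolvent T z' x - resolvent T z x = (z' - z) *: resolvent T z' (resolvent T z x).
Proof.
move=> rz rz'; have := resolvent_opshift z (resolvent T z x) rz'.
by rewrite opshiftK // => ->; rewrite addrC addKr.
Qed.

(** On [A] the growth of the resolvent is absorbed by one polynomial in [T], given by its list of
    roots [s]; only regular points are tested, so nothing is asserted about the spectrum itself. *)
Definition tame_on (A : set R[i]) := exists s (K : R), 0 <= K /\
  forall z x, A z -> regular T z -> nm (resolvent T z (polyop T s x)) <= K * nm x.

Lemma tame_onU A B : tame_on A -> tame_on B -> tame_on (A `|` B).
Proof.
move=> [s [K [K0 hK]]] [t [L [L0 hL]]].
have [C C0 hC] := polyop_bdd s; have [D D0 hD] := polyop_bdd t.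
exists (s ++ t), (K * D + L * C); split.
  by apply: addr_ge0; apply: mulr_ge0 => //; apply: ltW.
move=> z x [Az|Bz] rz; rewrite polyop_cat mulrDl -!mulrA.
  apply: le_trans (hK _ _ Az rz) _; apply: le_trans (ler_wpM2l K0 (hD x)) _.
  by rewrite lerDl; apply: mulr_ge0 => //; apply: mulr_ge0; [apply: ltW|apply: nm_ge0].
rewrite polyop_comm; apply: le_trans (hL _ _ Bz rz) _.
apply: le_trans (ler_wpM2l L0 (hC x)) _.
by rewrite lerDr; apply: mulr_ge0 => //; apply: mulr_ge0; [apply: ltW|apply: nm_ge0].
Qed.

Lemma tame_onS A B : A `<=` B -> tame_on B -> tame_on A.
Proof.
move=> AB [s [K [K0 hK]]]; exists s, K; split => // z x /AB; exact: hK.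
Qed.

(* Compactness of a large disc, phrased with ultrafilters: the sets whose
   complement is tame form a filter. *)
Lemma locally_tame_globally :
  (forall lam, exists2 d : R, 0 < d & tame_on [set z | nm (z - lam) < d]) -> tame_on setT.
Proof.
move=> loc; apply: contrapT => nT.
pose F : set_system R[i] := [set B | tame_on (~` B)].
have tame0 : tame_on set0 by exists [::], 0; split.
have FF : ProperFilter F.
  apply: Build_ProperFilter_ex.
    move=> B FB; apply: contrapT => nB; apply: nT; apply: tame_onS FB => z _ Bz.
    by apply: nB; exists z.
  split; first by rewrite /F /= setCT.
  - by move=> A B FA FB; rewrite /F /= setCI; apply: tame_onU.
  - by move=> A B AB; apply: tame_onS; apply: subsetC.
have [U [UU FU]] := ultraFilterLemma FF.
have UP : ProperFilter U by exact: ultra_proper.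
have UD : U [set z | nm z <= CT + 1].
  apply: FU; exists [::], 1; split => // z x /negP; rewrite -ltNge => zC rz.
  have [_ h] := @regular_far z ltac:(lra); apply: le_trans (h x) _; rewrite mul1r.
  rewrite ler_pdivrMl; last by lra.
  by have := nm_ge0 x; nra.
have [lam hlam] := @ultra_lim R R[i] U UU (fun z => if nm z <= CT + 1 then z else 0)
  (CT + 1) (fun z => ltac:(by move=> /=; case: ifP => // _; rewrite nm0 addr_ge0)).
have [d d0 td] := loc lam.
have h1 : U (~` [set z | nm (z - lam) < d]) by apply: FU; rewrite /F /= setCK.
have [z /= [[zD hz] nz]] := filter_ex (filterI (filterI UD (hlam _ d0)) h1).
by apply: nz; move: hz; rewrite zD.
Qed.

(** One root is removed at a time: [R_z (T - a) = 1 + (z - a) R_z], and [z - a] is bounded away from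
    0. *)
Lemma resolvent_bound_off s (K eta : R) : 0 <= K -> 0 < eta -> exists2 B : R, 0 < B &
  forall z, regular T z -> (forall a, a \in s -> eta <= nm (z - a)) ->
    (forall x, nm (resolvent T z (polyop T s x)) <= K * nm x) ->
    forall x, nm (resolvent T z x) <= B * nm x.
Proof.
move=> K0 eta0; elim: s K K0 => [|a s IH] K K0.
  exists (K + 1); first by lra.
  move=> z rz _ hK x; apply: le_trans (hK x) _; apply: ler_wpM2r; [exact: nm_ge0|lra].
have [C C0 hC] := polyop_bdd s.
have [|B B0 hB] := IH ((K + C) / eta); first by apply: divr_ge0; lra.
exists B => // z rz hs hK; apply: hB => // [b bs|x].
  by apply: hs; rewrite inE bs orbT.
have := hK x; rewrite /= resolvent_opshift // => h.
have := nm_sub ((z - a) *: resolvent T z (polyop T s x)) (- polyop T s x).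
rewrite nmZ nmN opprK [_ + polyop T s x]addrC => h1.
have := hs a (mem_head _ _); have := hC x; have := nm_ge0 (resolvent T z (polyop T s x)).
set v := nm (resolvent _ _ _) in h1 * => v0 h2 h3.
by rewrite mulrAC ler_pdivlMr // mulrC; nra.
Qed.

Lemma seq_separated (s : seq R[i]) (z : R[i]) : z \notin s ->
  exists2 eta : R, 0 < eta & forall a, a \in s -> eta <= nm (z - a).
Proof.
elim: s => [|b s IH]; first by exists 1.
rewrite inE negb_or => /andP[zb /IH [eta eta0 h]].
exists (Num.min eta (nm (z - b))); first by rewrite lt_min eta0 nm_gt0 subr_eq0.
move=> a; rewrite inE => /orP[/eqP ->|as_]; first by rewrite ge_min lexx orbT.
by rewrite ge_min h.
Qed.

(** Continuation along a ray from infinity down to [z] that misses [s]. Just beyond the supremum of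
    the nonregular parameters the resolvent is uniformly bounded, so regularity reaches back past
    that supremum. *)
Lemma regular_off s (K : R) : 0 <= K ->
  (forall z x, regular T z -> nm (resolvent T z (polyop T s x)) <= K * nm x) ->
  forall z, z \notin s -> regular T z.
Proof.
move=> K0 hK z zs; apply: contrapT => nz.
have [m [_ ms]] := avoid_seq [seq complex.Im (a - z) / complex.Re (a - z) | a <- s] ltr01.
pose u : R[i] := 1 +i* m.
have nu : 0 < nm u.
  by rewrite nm_gt0; apply/eqP => /(congr1 (@complex.Re R)) /= /eqP; rewrite oner_eq0.
pose ray (t : R) := z + t%:C * u.
have ray_off t : ray t \notin s.
  apply/negP => rs; have [t0|t0] := eqVneq t 0.
    by move: rs zs; rewrite /ray t0 mul0r addr0 => ->.
  move: ms; apply/negP; rewrite negbK; apply/mapP; exists (ray t) => //.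
  have -> : ray t - z = t +i* (t * m).
    rewrite /ray addrAC subrr add0r; apply/eqP; rewrite eq_complex /=.
    by apply/andP; split; apply/eqP; ring.
  by rewrite /= mulrC mulKf.
pose E := [set t : R | 0 <= t /\ ~ regular T (ray t)].
have E0 : E 0 by split => //; rewrite /ray mul0r addr0.
have nray t t' : nm (ray t - ray t') = `|t - t'| * nm u.
  have -> : ray t - ray t' = (t - t')%:C * u by rewrite /ray rmorphB /=; ring.
  by rewrite nmM nm_real.
have hE : has_sup E.
  split; first by exists 0.
  exists ((CT + nm z) / nm u) => t [t0 nt]; rewrite leNgt; apply/negP => ht; apply: nt.
  suff tfar : CT < nm (ray t) by exact: (proj1 (regular_far tfar)).
  move: ht; rewrite ltr_pdivrMr // => ht.
  have := nm_sub (t%:C * u) (- z); rewrite opprK nmN nmM nm_real ger0_norm // addrC.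
  by rewrite /ray [_ * u + z]addrC; lra.
pose ts := sup E.
have [eta eta0 heta] := seq_separated (ray_off ts).
have [B B0 hB] := @resolvent_bound_off s K (eta / 2) K0 ltac:(lra).
(* Moving by [r] from [ray ts] keeps a distance [eta / 2] from [s], so the bound [B] applies at
   [ts + r]; parameters in [(ts - r, ts]] are then within [2 * r * nm u <= 1 / (2 * B)], inside the
   Neumann radius. *)
pose r := Num.min (eta / 2) (1 / (4 * B)) / nm u.
have r0 : 0 < r.
  apply: divr_gt0 => //; rewrite lt_min; apply/andP; split; first by lra.
  by apply: divr_gt0 => //; lra.
have ru : r * nm u <= eta / 2 /\ r * nm u * (4 * B) <= 1.
  have -> : r * nm u = Num.min (eta / 2) (1 / (4 * B)) by rewrite /r divfK // gt_eqF.
  split; first by rewrite ge_min lexx.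
  rewrite -ler_pdivlMr; last by lra.
  by rewrite ge_min lexx orbT.
have r1 : regular T (ray (ts + r)).
  apply: contrapT => n1; have : E (ts + r).
    have ts0 : 0 <= ts by exact: (sup_upper_bound hE E0).
    by split => //; apply: addr_ge0 => //; apply: ltW.
  by move=> /(sup_upper_bound hE); rewrite -/ts; lra.
have b1 x : nm (resolvent T (ray (ts + r)) x) <= B * nm x.
  apply: hB => // [a as_|y]; last exact: hK.
  have := heta a as_; have := nm_tri (ray (ts + r)) (ray ts) a.
  rewrite nray; have -> : ts - (ts + r) = - r by ring.
  by rewrite normrN ger0_norm ?(ltW r0) //; lra.
have [t [t0 nt] ht] := sup_adherent r0 hE; rewrite -/ts in ht.
have tts : t <= ts by apply: sup_upper_bound.
apply: nt; apply: (regular_near (ltW B0) r1 b1); rewrite nray.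
rewrite distrC ger0_norm; last by lra.
case: ru => ru1 ru2; nra.
Qed.

(** The second order remainder of [z -> R_z y] is [(z' - z)^2 R_{z'} R_z R_z y], with three
    resolvents; taking [y] in the range of the cube of the polynomial gives each of them a factor
    that makes it bounded. Once [R_z y = 0] for a single regular [z], [y = 0]. *)
Lemma tame_algebraic : tame_on setT -> exists s, forall x, polyop T s x = 0.
Proof.
move=> [s [K [K0 hK]]]; have hK' z x := hK z x I.
have reg := regular_off K0 hK'.
exists (s ++ s ++ s) => x; rewrite !polyop_cat.
set y := polyop T s _.
have Ky z z' : regular T z -> regular T z' ->
    nm (resolvent T z' (resolvent T z (resolvent T z y))) <= K ^+ 3 * nm x.
  move=> rz rz'.
  have -> : resolvent T z (resolvent T z y) =
      polyop T s (resolvent T z (polyop T s (resolvent T z (polyop T s x)))).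
    rewrite /y (resolvent_polyop s (polyop T s (polyop T s x)) rz).
    rewrite (resolvent_polyop s (resolvent T z (polyop T s (polyop T s x))) rz).
    by rewrite (resolvent_polyop s (polyop T s x) rz).
  apply: le_trans (hK' _ _ rz') _; rewrite exprS -mulrA; apply: ler_wpM2l => //.
  apply: le_trans (hK' _ _ rz) _; rewrite expr2 -mulrA; apply: ler_wpM2l => //.
  exact: hK'.
have decay e : 0 < e -> exists r, forall z, z \notin s -> r <= nm z ->
    nm (resolvent T z y) <= e.
  move=> e0; exists (CT + 1 + nm y / e) => z _ rz.
  have p0 : 0 <= nm y / e by apply: divr_ge0; [apply: nm_ge0|apply: ltW].
  have [_ h] := @regular_far z ltac:(lra); apply: le_trans (h y) _.
  rewrite ler_pdivrMl; last by lra.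
  have -> : nm y = (nm y / e) * e by rewrite divfK // gt_eqF.
  by apply: ler_wpM2r; [apply: ltW|lra].
have zero z : z \notin s -> resolvent T z y = 0.
  apply: (punctured_liouville (P' := fun z => resolvent T z (resolvent T z y))
    (C := K ^+ 3 * nm x) _ _ decay).
    by apply: mulr_ge0; [apply: exprn_ge0|apply: nm_ge0].
  move=> a b /reg ra /reg rb; rewrite resolvent_identity //.
  rewrite -scalerBr resolvent_identity // scalerA nmZ nmM -expr2 mulrC.
  by apply: ler_wpM2r; [apply: exprn_ge0; apply: nm_ge0|apply: Ky].
have [r hr] := decay 1 ltr01.
have [z0 z0s] : exists z, z \notin s.
  have [m [_ ms]] := avoid_seq [seq complex.Re a | a <- s] ltr01.
  exists m%:C; apply: contra ms => ms; apply/mapP; by exists m%:C.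
by rewrite -(opshiftK y (reg _ z0s)) zero // linear0.
Qed.
End RegularSet.

Theorem mainTheorem1 (R : realType) (X : completeNormedModType R[i])
  (HX : infinite_dimensional_space X)
  (T : {linear X -> X}) (HT : bounded_operator T)
  (eps : R) (Heps : 0 < eps) :
  exists F : {linear X -> X},
    [/\ bounded_operator F, rank_le1 F, opnorm_lt F eps &
      exists L : set X, half_space L /\ op_invariant (fun x => T x - F x) L].
Proof.
have [CT CT0 TC] := continuous_bdd HT.
suff : perturbed_half_space T eps by [].
(* Either every point has a tame neighbourhood, and [T] is algebraic, or some [lam] has none: no
   polynomial in [T], in particular no power of [T - lam], then keeps the resolvent bounded near
   [lam]. *)
have [loc|] := pselect (forall lam, exists2 d : R, 0 < d &
    tame_on T [set z | nm (z - lam) < d]).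
  have [s hs] := tame_algebraic CT0 TC (locally_tame_globally CT0 TC loc).
  have [a ha] := algebraic_infinite_kernel HX hs.
  exact: (perturbed_infinite_kernel TC Heps ha).
move=> /existsNP[lam nloc].
have wild d s K : 0 < d -> exists z x, [/\ regular T z, nm (z - lam) < d &
    K * nm x < nm (resolvent T z (polyop T s x))].
  move=> d0; apply: contrapT => h; apply: nloc; exists d => //.
  exists s, `|K|; split => // z x zd rz; rewrite leNgt; apply/negP => hlt.
  apply: h; exists z, x; split => //; apply: le_lt_trans hlt.
  by apply: ler_wpM2r; [apply: nm_ge0|apply: ler_norm].
have reg d : 0 < d -> exists2 z, regular T z & nm (z - lam) < d.
  by move=> d0; have [z [x [rz zd _]]] := wild d [::] 0 d0; exists z.
have [kinf|kfin] := pselect (infinite_dimensional [set x | opshift T lam x = 0]).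
  exact: (perturbed_infinite_kernel TC Heps kinf).
have [[k stable]|grow] := pselect (exists k, forall x,
    iter k.+1 (opshift T lam) x = 0 -> iter k (opshift T lam) x = 0).
  apply: (perturbed_stable_kernel TC Heps stable) => d K d0.
  by have [z [x h]] := wild d (nseq k lam) K d0; exists z, x; rewrite -polyop_nseq.
have [|x [x0 Sx0 SxS]] := jordan_chain kfin.
  move=> k; apply: contrapT => h; apply: grow; exists k => x hx.
  by apply: contrapT => hk; apply: h; exists x.
exact: (perturbed_chain TC Heps x0 Sx0 SxS reg).
Qed.
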